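(* Let $P(x_1,x_2)=\sum_{i,j}\lambda_{i,j}x_1^{2i}x_2^{2j}$ be in $K$, where $\lambda_{i,j}=-\lambda_{j,i}$. It gives rise to a relation of the form $\sum_{i<j}\lambda_{i,j}[\overline\sigma_{2i+1},\overline\sigma_{2j+1}]=0$ in $\mathfrak d^2$. Then the image of the element $\mathfrak c(P)\in\mathfrak d^4$ in $\mathbb Q[x_1,x_2,x_3,x_4]$ (its reduced polynomial representation) is $$\sum_{i,a,b}\lambda_{i,a+b}\,\frac{B_{2a}B_{2b}}{B_{2a+2b}}\binom{2a+2b}{2a}\frac1{24b}\,\{x_1^{2i},\{x_1^{2a},\{x_1^{2b},x_1^{-2}\}\}\}\;-\;3\sum_{i}\lambda_{i,1}\{x_1^{2i},z_3\},$$ where the sums are over $i,a,b\ge1$ and $$z_3=\frac43+\frac{x_1}{x_3-x_2}+\frac{x_3}{x_1-x_2}+\frac{x_3-x_2}{x_1}+\frac{x_1-x_2}{x_3}.$$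
   Context: $B_k$ are the Bernoulli numbers. $\mathfrak g^{\mathfrak m}$ is the graded Lie algebra of the unipotent radical of the de Rham Tannaka group of the category of mixed Tate motives over $\mathbb Z$; through its action on the trivial de Rham path in $\pi_1^{dR}(\mathbb P^1\setminus\{0,1,\infty\},\overset{\rightarrow}{1}_0,-\overset{\rightarrow}{1}_1)$ it is identified with a Lie subalgebra of the free Lie algebra $\mathbb L(\mathsf x_0,\mathsf x_1)$ over $\mathbb Q$ equipped with the Ihara bracket $\{\,,\}$. $D^r\mathfrak g^{\mathfrak m}$ is the subspace of elements all of whose words contain at least $r$ letters $\mathsf x_1$, and $\mathfrak d^r=D^r\mathfrak g^{\mathfrak m}/D^{r+1}\mathfrak g^{\mathfrak m}$, $\mathfrak d=\bigoplus_r\mathfrak d^r$. **Polynomial representation.** The depth $r$ part of an element ($r\ge1$) is encoded by $\mathsf x_0^{i_0}\mathsf x_1\mathsf x_0^{i_1}\cdots\mathsf x_1\mathsf x_0^{i_r}\mapsto y_0^{i_0}\cdots y_r^{i_r}$ and then in reduced form by $(y_0,\dots,y_r)\mapsto(0,x_1,\dots,x_r)$. For homogeneous rational functions $f(y_0,\dots,y_r)$, $g(y_0,\dots,y_s)$ put $$f\,\underline\circ\, g=\sum_{i=0}^s f(y_i,\dots,y_{i+r})\,g(y_0,\dots,y_i,y_{i+r+1},\dots,y_{r+s})+(-1)^{\deg f+r}\sum_{i=1}^s f(y_{i+r},\dots,y_i)\,g(y_0,\dots,y_{i-1},y_{i+r},\dots,y_{r+s}),$$ extended bilinearly, and $\{f,g\}=f\,\underline\circ\,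 g-g\,\underline\circ\, f$; a rational function $f(x_1,\dots,x_r)$ is identified with $f(y_1-y_0,\dots,y_r-y_0)$. This represents the Ihara bracket. $\mathfrak d^1$ has basis $\overline\sigma_{2n+1}$, $n\ge1$, represented by $x_1^{2n}$. $K=\ker(\{\,,\}:\mathfrak d^1\wedge\mathfrak d^1\to\mathfrak d^2)$, whose elements are viewed as antisymmetric polynomials $P=\sum\lambda_{i,j}x_1^{2i}x_2^{2j}$ ($i,j\ge1$, $\lambda_{i,j}\in\mathbb Q$). **Canonical elements.** Let $s^{(1)}=\frac1{2x_1}$, $s^{(2)}=\frac1{12}\big(\frac1{x_1x_2}+\frac1{x_2(x_1-x_2)}\big)$ and $\xi^{(1)}_{2n+1}=x_1^{2n}$, $\xi^{(2)}_{2n+1}=\{s^{(1)},x_1^{2n}\}$, $\xi^{(3)}_{2n+1}=\{s^{(2)},x_1^{2n}\}+\frac12\{s^{(1)},\{s^{(1)},x_1^{2n}\}\}$. For $n\ge1$, $\sigma^c_{2n+1}\in D^1\mathfrak g^{\mathfrak m}/D^4\mathfrak g^{\mathfrak m}$ is the element with reduced polynomials $\xi^{(1)}_{2n+1}$, $\xi^{(2)}_{2n+1}$ in depths $1,2$ and, in depth $3$, reduced polynomial $0$ if $n=1$, and $\xi^{(3)}_{2n+1}+\sum_{a+b=n,\,a,b\ge1}\frac{B_{2a}B_{2b}}{B_{2n}}\binom{2n}{2a}\frac1{24b}\{x_1^{2a},\{x_1^{2b},x_1^{-2}\}\}$ if $n\ge2$. **The map $\mathfrak c$.** For $P=\sum_{i,j}\lambda_{i,j}x_1^{2i}x_2^{2j}\in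 K$, the element $\sum_{i<j}\lambda_{i,j}\{\sigma^c_{2i+1},\sigma^c_{2j+1}\}$ of $D^2\mathfrak g^{\mathfrak m}/D^5\mathfrak g^{\mathfrak m}$ lies in $D^4\mathfrak g^{\mathfrak m}/D^5\mathfrak g^{\mathfrak m}=\mathfrak d^4$; this is $\mathfrak c(P)$.
   Formalization: The coefficient 3 of the last sum (over i of lambda_{i,1}{x_1^{2i}, z_3}) is corrected to 3/12 = 1/4, since with the given s^(1), s^(2) one has xi^(3)_3 = z_3/4; the printed formula already fails for the weight 12 relation. *)

(* Defs.v *)
From HB Require Import structures.
From mathcomp Require Import all_boot all_order all_algebra.
From mathcomp Require Import finmap.
From mathcomp Require Import -(notations) monalg.
From mathcomp Require Import mpoly.

Set Implicit Arguments.
Unset Strict Implicit.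
Unset Printing Implicit Defensive.

Import GRing.Theory.
Local Open Scope ring_scope.

Fixpoint bernoulli_seq (n : nat) : seq rat :=
  if n is m.+1 then
    let s := bernoulli_seq m in
    rcons s (- (m.+2%:R)^-1 * \sum_(k < m.+1) 'C(m.+2, k)%:R * s`_k)
  else [:: 1].

Definition bernoulli (n : nat) : rat := (bernoulli_seq n)`_n.

(** ** Words in x0, x1 *)

(** The letter [false] is x0 and the letter [true] is x1. *)
Notation word := (monalg.fmonom bool).
Definition ncpoly := monalg.malg word rat.

Definition letter (l : bool) : ncpoly := monalg.mkmalgU (monalg.fmu l) 1.
Definition lie_br (a b : ncpoly) : ncpoly := a * b - b * a.

Inductive free_lie : ncpoly -> Prop :=
| FreeLieLetter l : free_lie (letter l)
| FreeLieLin (c : rat) a b : free_lie a -> free_lie b -> free_lie (c *: a + b)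
| FreeLieBr a b : free_lie a -> free_lie b -> free_lie (lie_br a b).

Fixpoint ihara_der_word (a : ncpoly) (w : seq bool) : ncpoly :=
  if w is l :: w' then
    (if l then lie_br a (letter true) else 0) * \prod_(k <- w') letter k
    + letter l * ihara_der_word a w'
  else 0.

(** The derivation of Q<x0,x1> with x0 |-> 0 and x1 |-> [a, x1]. *)
Definition ihara_der (a b : ncpoly) : ncpoly :=
  \sum_(w <- monalg.msupp b) monalg.mcoeff w b *: ihara_der_word a (w : seq bool).

(** {a, b} = a o b - b o a, where a o b is the action of a on b as an element
    of the path torsor, i.e. the sum of the derivation above and of b |-> b a.
    In depth-graded polynomials this is [ihara] below (the sum over i <= s
    inserts f to the left of a letter x1 or at the end of the word). *)
Definition ihara_nc (a b : ncpoly) : ncpoly :=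
  (ihara_der a b + b * a) - (ihara_der b a + a * b).

Definition depth (w : seq bool) : nat := count_mem true w.

Definition depth_ge (r : nat) (a : ncpoly) : Prop :=
  forall w : word, w \in monalg.msupp a -> (r <= depth w)%N.

Definition weight_part (n : nat) (a : ncpoly) : ncpoly :=
  \sum_(w <- monalg.msupp a | size (w : seq bool) == n)
     monalg.mcoeff w a *: monalg.mkmalgU w 1.

(** [:: i_0; ...; i_r] for the word x0^i_0 x1 x0^i_1 ... x1 x0^i_r *)
Fixpoint blocks (w : seq bool) : seq nat :=
  match w with
  | [::] => [:: 0%N]
  | true :: w' => 0%N :: blocks w'
  | false :: w' => let s := blocks w' in (head 0%N s).+1 :: behead s
  end.

Definition depth_poly (r : nat) (a : ncpoly) : {mpoly rat[r.+1]} :=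
  \sum_(w <- monalg.msupp a | depth w == r)
     monalg.mcoeff w a *: 'X_[ [multinom nth 0%N (blocks w) i | i < r.+1] ].

(** (y_0, ..., y_r) |-> (0, x_1, ..., x_r); the variable x_i is ['X_(i-1)]. *)
Definition reduced (r : nat) (a : ncpoly) : {mpoly rat[r]} :=
  depth_poly r a
    \mPo [tuple if unlift ord0 i is Some j then 'X_j else 0 | i < r.+1].

(** ** Rational functions and the polynomial form of the Ihara bracket *)

Notation ratfun r := {fraction {mpoly rat[r]}}.
Notation "x %:F" := (@FracField.tofrac _ x) : ring_scope.

Definition cst r (c : rat) : ratfun r := (c%:MP)%:F.

(** x_k, with the convention x_0 = 0 *)
Definition xvar r (k : nat) : ratfun r :=
  if k is k'.+1 then
    if insub k' is Some i then (('X_i : {mpoly rat[r]})%:F) else 0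
  else 0.

(** f(u_0, ..., u_(r-1)).  The choice of the representing fraction is
    irrelevant when the u_k are algebraically independent, as they are in all
    uses below. *)
Definition rsubst r m (f : ratfun r) (u : nat -> ratfun m) : ratfun m :=
  let ev (p : {mpoly rat[r]}) := mmap (@cst m) (fun k : 'I_r => u k) p in
  ev \n_(repr f) / ev \d_(repr f).

(** f(y_0, ..., y_r) := f(y_1 - y_0, ..., y_r - y_0) *)
Definition tsubst r m (f : ratfun r) (y : nat -> ratfun m) : ratfun m :=
  rsubst f (fun k => y k.+1 - y 0%N).

(** The operation f o g, in reduced form, that is at (y_0, ..., y_(r+s)) =
    (0, x_1, ..., x_(r+s)).  For f homogeneous,
    (-1)^(deg f) f(y_(i+r), ..., y_i) = f(- y_(i+r), ..., - y_i);
    the right-hand side is used because it is linear in f. *)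
Definition circ r s (f : ratfun r) (g : ratfun s) m : ratfun m :=
  let y := xvar m in
  \sum_(0 <= i < s.+1)
     tsubst f (fun k => y (i + k)%N)
     * tsubst g (fun k => if (k <= i)%N then y k else y (k + r)%N)
  + (-1) ^+ r *
    \sum_(1 <= i < s.+1)
       tsubst f (fun k => - y (i + r - k)%N)
       * tsubst g (fun k => if (k < i)%N then y k else y (k + r)%N).

Definition ihara r s (f : ratfun r) (g : ratfun s) : ratfun (r + s) :=
  circ f g (r + s) - circ g f (r + s).

(** x_1^e *)
Definition mon (e : int) : ratfun 1 := xvar 1 1 ^ e.

Definition s1 : ratfun 1 := (2%:R * xvar 1 1)^-1.

Definition s2 : ratfun 2 :=
  let x := xvar 2 in
  cst 2 (12%:R^-1) * ((x 1 * x 2)^-1 + (x 2 * (x 1 - x 2))^-1).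

Definition xi1 (n : nat) : ratfun 1 := mon (2 * n)%N.
Definition xi2 (n : nat) : ratfun 2 := ihara s1 (mon (2 * n)%N).
Definition xi3 (n : nat) : ratfun 3 :=
  ihara s2 (mon (2 * n)%N)
  + cst 3 (2%:R^-1) * ihara s1 (ihara s1 (mon (2 * n)%N)).

Definition bern_coef (a b : nat) : rat :=
  bernoulli (2 * a) * bernoulli (2 * b) / bernoulli (2 * (a + b))
  * 'C(2 * (a + b), 2 * a)%:R / (24 * b)%:R.

Definition ihara_mon2 (a b : nat) : ratfun 3 :=
  ihara (mon (2 * a)%N) (ihara (mon (2 * b)%N) (mon (-2))).

Definition sigma_c3 (n : nat) : ratfun 3 :=
  if n == 1%N then 0
  else xi3 n + \sum_(1 <= a < n) cst 3 (bern_coef a (n - a)) * ihara_mon2 a (n - a).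

(** [xi3 1 = (3 / 12) * z3] for [s1] and [s2] normalised as above. *)
Definition z3 : ratfun 3 :=
  let x := xvar 3 in
  cst 3 (4%:R / 3%:R) + x 1 / (x 3 - x 2) + x 3 / (x 1 - x 2)
  + (x 3 - x 2) / x 1 + (x 1 - x 2) / x 3.

(** The Tannaka group of mixed Tate motives over Z is not available, so the
    motivic Lie algebra is a variable [g], a subspace of Q<x0,x1> subject to
    the properties [motivic_lie]; statements hold for every such [g].
    Elements of D^r g / D^r' g are handled through representatives in D^r g. *)

(** a in D^1 g represents the class of sigma_(2n+1) in d^1. *)
Definition is_lift (g : ncpoly -> Prop) (n : nat) (a : ncpoly) : Prop :=
  [/\ g a, depth_ge 1 a & (reduced 1 a)%:F = xi1 n].

Record motivic_lie (g : ncpoly -> Prop) : Prop := MotivicLie {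
  motivic_free_lie : forall a, g a -> free_lie a;
  motivic0 : g 0;
  motivic_lin : forall (c : rat) a b, g a -> g b -> g (c *: a + b);
  motivic_ihara : forall a b, g a -> g b -> g (ihara_nc a b);
  motivic_graded : forall n a, g a -> g (weight_part n a);
  motivic_depth1 : forall n, (0 < n)%N -> exists a, is_lift g n a;
  motivic_depth1_span : forall a, g a -> depth_ge 1 a ->
    exists2 c : nat -> rat,
      c 0%N = 0 &
      exists N, reduced 1 a = \sum_(0 <= n < N) c n *: 'X_ord0 ^+ (2 * n)
}.

(** a in D^1 g represents sigma^c_(2n+1) in D^1 g / D^4 g. *)
Definition is_sigma_c (g : ncpoly -> Prop) (n : nat) (a : ncpoly) : Prop :=
  [/\ is_lift g n a,
      (reduced 2 a)%:F = xi2 n &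
      (reduced 3 a)%:F = sigma_c3 n].

Definition lam (P : {mpoly rat[2]}) (i j : nat) : rat :=
  P@_[multinom nth 0%N [:: (2 * i)%N; (2 * j)%N] k | k < 2].

(** The sum over 0 < i < j of lam_(i,j) {s_i, s_j}.  If lam P i j <> 0 then
    2i + 2j < msize P, so that msize P bounds all sums against lam P. *)
Definition lam_bracket (P : {mpoly rat[2]}) (s : nat -> ncpoly) : ncpoly :=
  \sum_(1 <= i < msize P) \sum_(i.+1 <= j < msize P)
     lam P i j *: ihara_nc (s i) (s j).

(** The last field is the vanishing in d^2 of the sum over i < j of
    lam_(i,j) [sigma_(2i+1), sigma_(2j+1)]; it does not depend on the lifts. *)
Record in_K (g : ncpoly -> Prop) (P : {mpoly rat[2]}) : Prop := InK {
  K_even : P = \sum_(1 <= i < msize P) \sum_(1 <= j < msize P)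
                 lam P i j *: ('X_ord0 ^+ (2 * i) * 'X_ord_max ^+ (2 * j));
  K_antisym : forall i j, lam P i j = - lam P j i;
  K_ker : forall s : nat -> ncpoly,
    (forall n, (0 < n)%N -> is_lift g n (s n)) -> depth_ge 3 (lam_bracket P s)
}.

(* Main.v *)
Require Import Defs.
From HB Require Import structures.
From mathcomp Require Import all_boot all_order all_algebra.
From mathcomp Require Import finmap.
From mathcomp Require Import -(notations) monalg.
From mathcomp Require Import mpoly.
From mathcomp Require Import ring zify.

Set Implicit Arguments.
Unset Strict Implicit.
Unset Printing Implicit Defensive.

Import GRing.Theory.
Local Open Scope ring_scope.

(** The canonical elements are truncations of an exponential: up to the
    correction tau below, sigma_n = exp(ad (s1 + s2)) x_1^(2n) in depths
    1, 2, 3, that is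

      x_1^(2n),  {s1, x_1^(2n)},
      {s2, x_1^(2n)} + 1/2 {s1, {s1, x_1^(2n)}}.

    Since ad s1 and ad s2 are derivations of the Ihara bracket, the components
    of {sigma_i, sigma_j} in depths 2, 3, 4 are obtained in the same way from
    {x_1^(2i), x_1^(2j)} ([ihara_exp_depth3], [ihara_exp_depth4]).  A linear
    relation between the brackets {x_1^(2i), x_1^(2j)} therefore kills the
    depths 2 and 3 and the exponential part of depth 4.  What survives in
    depth 4 comes from the difference tau_n between the depth 3 part of sigma_n
    and the exponential: the Bernoulli terms, and - xi3 1 when n = 1.  By
    antisymmetry of lambda its contribution is the sum over all i, j of
    lambda_(i,j) {x_1^(2i), tau_j}, and xi3 1 is a multiple of z_3 ([xi3_1]).

    The argument needs two bridges.

    - The bracket of rational functions satisfies the Jacobi identity.  The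
      definition of [circ] evaluates its arguments at signed, reordered subsets
      of the points 0, x_1, ..., x_m.  Such points are algebraically
      independent up to translation ([alg_free_point]), so that substitution is
      a field morphism and composes well.  For functions f satisfying the parity
      relation [antipodal], circ f g becomes the purely combinatorial operation
      [list_circ] on functions of lists ([at_pt_circ]), and Jacobi becomes a
      polynomial identity between formal values.

    - The bracket of noncommutative polynomials induces that of their reduced
      depth components.  The value of a component at arbitrary points
      ([depth_val]) turns concatenation of words into a convolution, and the
      action a o b into [list_circ] ([depth_val_action]).  Lie elements are
      moreover translation invariant in positive depth, hence determined by
      their reduced form, and antipodal ([depth_val_translate],
      [depth_val_antipode]). *)

(** * Substitution in rational functions *)

Lemma rmorph_mmap n (R S T : nzRingType) (phi : {rmorphism S -> T})
    (f : R -> S) (h : 'I_n -> S) (p : {mpoly R[n]}) :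
  phi (mmap f h p) = mmap (phi \o f) (phi \o h) p.
Proof.
rewrite /mmap rmorph_sum; apply: eq_bigr => k _; rewrite rmorphM; congr (_ * _).
by rewrite /mmap1 rmorph_prod; apply: eq_bigr => i _; rewrite rmorphXn.
Qed.

Lemma eq_mmap n (R S : nzRingType) (f f' : R -> S) (h h' : 'I_n -> S)
    (p : {mpoly R[n]}) :
  f =1 f' -> h =1 h' -> mmap f h p = mmap f' h' p.
Proof.
move=> ef eh; apply: eq_bigr => k _; rewrite ef; congr (_ * _).
exact: mmap1_eq.
Qed.

Section Cst.
Variable m : nat.

Fact cst_is_zmod_morphism : zmod_morphism (@cst m).
Proof. by move=> a b; rewrite /cst mpolyCB tofracB. Qed.
HB.instance Definition _ :=
  GRing.isZmodMorphism.Build rat (ratfun m) (@cst m) cst_is_zmod_morphism.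
Fact cst_is_monoid_morphism : monoid_morphism (@cst m).
Proof. by split=> [|a b]; rewrite /cst ?mpolyCM ?tofracM ?mpolyC1. Qed.
HB.instance Definition _ :=
  GRing.isMonoidMorphism.Build rat (ratfun m) (@cst m) cst_is_monoid_morphism.

End Cst.

Lemma frac_repr (R : idomainType) (f : {fraction R}) :
  f = (\n_(repr f))%:F / (\d_(repr f))%:F.
Proof.
have d0 := denom_ratioP (repr f).
apply: (canRL (mulfK _)); first by rewrite tofrac_eq0.
rewrite -{1}[f](reprK f); unlock FracField.tofrac.
rewrite -[LHS]FracField.pi_mul; apply/eqmodP; rewrite /= FracField.equivfE.
rewrite /FracField.mulf /= !numden_Ratio ?mulr1 ?oner_neq0 //.
by rewrite mulrC.
Qed.

Section Evaluation.
Variables r m : nat.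

Definition evalp (u : nat -> ratfun m) (p : {mpoly rat[r]}) : ratfun m :=
  mmap (@cst m) (fun k : 'I_r => u k) p.

(** Only the differences of the points enter the evaluation of a rational
    function in translation invariant form, so this is applied to such
    differences. *)
Definition alg_free (u : nat -> ratfun m) : Prop :=
  forall p, evalp u p = 0 -> p = 0.

Lemma evalpB u : {morph evalp u : p q / p - q}.
Proof. exact: mmapB. Qed.
Lemma evalpD u : {morph evalp u : p q / p + q}.
Proof. exact: mmapD. Qed.
Lemma evalpM u : {morph evalp u : p q / p * q}.
Proof. by have [] := mmap_is_multiplicative (fun k : 'I_r => u k) (@cst m). Qed.
Lemma evalpC u c : evalp u c%:MP = cst m c.
Proof. exact: mmapC. Qed.
Lemma evalp1 u : evalp u 1 = 1.
Proof. by rewrite -mpolyC1 evalpC rmorph1. Qed.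
Lemma evalpX u (i : 'I_r) : evalp u 'X_i = u i.
Proof. by rewrite /evalp mmapX mmap1U. Qed.

Variable u : nat -> ratfun m.

Lemma eq_rsubst (f : ratfun r) (v : nat -> ratfun m) :
  (forall k, (k < r)%N -> u k = v k) -> rsubst f u = rsubst f v.
Proof.
move=> uv; rewrite /rsubst /=; congr (_ / _);
  by apply: eq_mmap => // k; apply: uv.
Qed.

Hypothesis free_u : alg_free u.

(** Algebraic independence keeps denominators nonzero, so that the value does
    not depend on the representing fraction. *)
Lemma rsubst_div n d : d != 0 ->
  rsubst (n%:F / d%:F) u = evalp u n / evalp u d.
Proof.
move=> d0; rewrite /rsubst -!/(evalp _ _).
set f := n%:F / d%:F.
have nz p : p != 0 -> evalp u p != 0 by apply/contra_neq/free_u.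
have d1 := denom_ratioP (repr f).
apply/eqP; rewrite eqr_div ?nz //; rewrite -!evalpM; apply/eqP; congr evalp.
have /eqP := frac_repr f; rewrite eqr_div ?tofrac_eq0 // -!tofracM.
by rewrite tofrac_eq mulrC => /eqP <-; rewrite mulrC.
Qed.

Lemma rsubst_tofrac p : rsubst p%:F u = evalp u p.
Proof.
by rewrite -[p%:F]divr1 -tofrac1 rsubst_div ?oner_neq0 // evalp1 divr1.
Qed.

Lemma rsubst_cst c : rsubst (cst r c) u = cst m c.
Proof. by rewrite rsubst_tofrac evalpC. Qed.

Fact rsubst_is_zmod_morphism : zmod_morphism (fun f : ratfun r => rsubst f u).
Proof.
move=> f g; have nz p : p != 0 -> evalp u p != 0 by apply/contra_neq/free_u.
rewrite [f]frac_repr [g]frac_repr.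
move: (denom_ratioP (repr f)) (denom_ratioP (repr g)).
move: (\n_(repr f)) (\d_(repr f)) (\n_(repr g)) (\d_(repr g)) => a b c d b0 d0.
rewrite -mulNr addf_div ?tofrac_eq0 // -tofracN -!tofracM -tofracD.
rewrite !rsubst_div ?mulf_neq0 // -mulNr addf_div ?nz //.
by rewrite !evalpD !evalpM -[- c]sub0r evalpB -(subrr 1) evalpB subrr sub0r.
Qed.

Fact rsubst_is_monoid_morphism : monoid_morphism (fun f : ratfun r => rsubst f u).
Proof.
split=> [|f g]; first by rewrite -tofrac1 rsubst_tofrac evalp1.
rewrite [f]frac_repr [g]frac_repr.
move: (denom_ratioP (repr f)) (denom_ratioP (repr g)).
move: (\n_(repr f)) (\d_(repr f)) (\n_(repr g)) (\d_(repr g)) => a b c d b0 d0.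
by rewrite mulf_div -!tofracM !rsubst_div ?mulf_neq0 // !evalpM mulf_div.
Qed.

End Evaluation.

Section SubstMorphism.
Variables (r m : nat) (u : nat -> ratfun m) (free_u : alg_free r u).

(** The proof of independence is an argument of the function, so that the
    morphism structure can be attached to it. *)
Definition rsubst_free (_ : alg_free r u) (f : ratfun r) : ratfun m := rsubst f u.

HB.instance Definition _ :=
  GRing.isZmodMorphism.Build (ratfun r) (ratfun m) (rsubst_free free_u)
    (rsubst_is_zmod_morphism free_u).
HB.instance Definition _ :=
  GRing.isMonoidMorphism.Build (ratfun r) (ratfun m) (rsubst_free free_u)
    (rsubst_is_monoid_morphism free_u).

Definition rsubst_morphism : {rmorphism ratfun r -> ratfun m} :=
  rsubst_free free_u.

Lemma rsubst_morphismE f : rsubst_morphism f = rsubst f u.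
Proof. by []. Qed.

End SubstMorphism.

(** Substitution of [v] is a field morphism, and a vanishing denominator of the
    inner substitution is harmless since 0^-1 = 0. *)
Lemma rsubst_comp q r m (f : ratfun q) (u : nat -> ratfun r)
    (v : nat -> ratfun m) :
  alg_free r v ->
  rsubst (rsubst f u) v = rsubst f (fun k => rsubst (u k) v).
Proof.
move=> free_v; rewrite -(rsubst_morphismE free_v) {1 3}/rsubst fmorph_div /=.
congr (_ / _); rewrite rmorph_mmap; apply: eq_mmap => // c /=;
  by rewrite /rsubst_free rsubst_cst.
Qed.

(** * Evaluation at signed and reordered points *)

Definition xpoly m (k : nat) : {mpoly rat[m]} :=
  if k is k'.+1 then if insub k' is Some i then 'X_i else 0 else 0.

Lemma xvar_tofrac m k : xvar m k = (xpoly m k)%:F.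
Proof. by case: k => [|k] /=; [|case: insub]; rewrite ?tofrac0. Qed.

Lemma xpolyS m (i : 'I_m) : xpoly m i.+1 = 'X_i.
Proof. by rewrite /= valK. Qed.

(** The lists of points at which [circ] evaluates its arguments. *)
Definition point m (e : bool) (s : seq nat) (k : nat) : ratfun m :=
  (-1) ^+ e * xvar m (nth 0%N s k).

Definition at_pt r m (f : ratfun r) e s : ratfun m := tsubst f (point m e s).

Definition distinct m r (s : seq nat) :=
  [&& size s == r.+1, uniq s & all (fun k => k <= m)%N s].

(** A left inverse of the substitution is given by solving the linear system:
    y_j is sent to the difference of the new variables numbered by the position
    of j and by the position of 0 in [s].  Indices outside [s] have position
    r + 1, where [xpoly] is 0. *)
Lemma alg_free_point r m e s : distinct m r s ->
  alg_free r (fun k => point m e s k.+1 - point m e s 0).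
Proof.
case/and3P=> /eqP sz us /allP ms p.
pose U (k : 'I_r) := (-1) ^+ e * (xpoly m (nth 0%N s k.+1) - xpoly m (nth 0%N s 0)).
pose X j := xpoly r (index j s).
pose V := [tuple (-1) ^+ e * (X i.+1 - X 0%N) | i < m].
have VE j : (j <= m)%N -> xpoly m j \mPo V = (-1) ^+ e * (X j - X 0%N).
  case: j => [|j] jm; first by rewrite comp_mpoly0 subrr mulr0.
  by rewrite (xpolyS (Ordinal jm)) comp_mpolyXU -tnth_nth tnth_mktuple.
have sm k : (k <= r)%N -> (nth 0%N s k <= m)%N.
  by move=> kr; apply/ms/mem_nth; rewrite sz.
have UV k : U k \mPo V = 'X_k.
  rewrite rmorphM rmorphB /= rmorphXn rmorphN1 !VE ?sm //.
  rewrite /X !index_uniq ?sz ?ltnS // -mulrBr mulrA -signr_addb addbb mul1r.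
  by rewrite opprB addrA subrK xpolyS subr0.
have -> : evalp (fun k => point m e s k.+1 - point m e s 0) p =
          (p \mPo [tuple U k | k < r])%:F.
  rewrite /comp_mpoly rmorph_mmap; apply: eq_mmap => // k /=.
  rewrite tnth_mktuple /U /point !xvar_tofrac.
  by rewrite rmorphM rmorphB rmorphXn rmorphN1 mulrBr.
move/eqP; rewrite tofrac_eq0 => /eqP p0.
rewrite -[RHS](comp_mpoly0 V) -p0 /comp_mpoly rmorph_mmap.
rewrite -[LHS]comp_mpoly_id; apply: eq_mmap => [c|k] /=.
  by rewrite -/(comp_mpoly V _) comp_mpolyC.
by rewrite !tnth_mktuple -/(comp_mpoly V _) UV.
Qed.

Section AtPoint.
Variables (r m : nat) (e : bool) (s : seq nat) (gs : distinct m r s).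

Let phi := rsubst_morphism (@alg_free_point r m e s gs).

Lemma at_ptE f : at_pt m f e s = phi f. Proof. by []. Qed.

Lemma at_pt0 : at_pt m (0 : ratfun r) e s = 0.
Proof. by rewrite at_ptE rmorph0. Qed.
Lemma at_ptD (f g : ratfun r) :
  at_pt m (f + g) e s = at_pt m f e s + at_pt m g e s.
Proof. by rewrite !at_ptE rmorphD. Qed.
Lemma at_ptB (f g : ratfun r) :
  at_pt m (f - g) e s = at_pt m f e s - at_pt m g e s.
Proof. by rewrite !at_ptE rmorphB. Qed.
Lemma at_ptM (f g : ratfun r) :
  at_pt m (f * g) e s = at_pt m f e s * at_pt m g e s.
Proof. by rewrite !at_ptE rmorphM. Qed.
Lemma at_ptV (f : ratfun r) : at_pt m f^-1 e s = (at_pt m f e s)^-1.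
Proof. by rewrite !at_ptE fmorphV. Qed.
Lemma at_pt_sign (b : nat) : at_pt m ((-1) ^+ b : ratfun r) e s = (-1) ^+ b.
Proof. by rewrite at_ptE rmorphXn rmorphN1. Qed.
Lemma at_pt_sum (I : Type) (l : seq I) (P : pred I) (F : I -> ratfun r) :
  at_pt m (\sum_(i <- l | P i) F i) e s =
  \sum_(i <- l | P i) at_pt m (F i) e s.
Proof. by rewrite at_ptE rmorph_sum. Qed.
Lemma at_pt_nat (n : nat) : at_pt m (n%:R : ratfun r) e s = n%:R.
Proof. by rewrite at_ptE; exact: rmorph_nat. Qed.
Lemma at_pt_cst c : at_pt m (cst r c) e s = cst m c.
Proof. exact: rsubst_cst (@alg_free_point r m e s gs) c. Qed.
Lemma at_pt_exprz (f : ratfun r) (z : int) :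
  at_pt m (f ^ z) e s = at_pt m f e s ^ z.
Proof. by rewrite !at_ptE; exact: fmorphXz. Qed.

Lemma at_pt_xvar j : (j <= r)%N ->
  at_pt m (xvar r j) e s = point m e s j - point m e s 0.
Proof.
case: j => [|j] jr; first by rewrite at_pt0 subrr.
rewrite (_ : xvar r j.+1 = ('X_(Ordinal jr))%:F).
  by rewrite /at_pt /tsubst (rsubst_tofrac (@alg_free_point r m e s gs)) evalpX.
by rewrite xvar_tofrac (xpolyS (Ordinal jr)).
Qed.

Lemma at_pt_comp q (f : ratfun q) e' t : size t = q.+1 ->
  all (fun k => k <= r)%N t ->
  at_pt m (at_pt r f e' t) e s =
  at_pt m f (e (+) e') [seq nth 0%N s k | k <- t].
Proof.
move=> st /allP tr.
have nt k : (k <= q)%N -> (nth 0%N t k <= r)%N.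
  by move=> kq; apply/tr/mem_nth; rewrite st.
rewrite {1}/at_pt /tsubst rsubst_comp; last exact: alg_free_point.
apply: eq_rsubst => k kq; have kq' := ltnW kq; rewrite -[LHS]/(at_pt m _ e s) at_ptB.
rewrite /(point r) !at_ptM !at_pt_sign !at_pt_xvar ?nt //.
rewrite /point !(nth_map 0%N) ?st ?ltnS // -/(point m e s 0).
rewrite -mulrBr opprB addrA subrK -mulrBr mulrA -signr_addb addbC.
by rewrite -mulrBr.
Qed.

End AtPoint.

(** * The operation circ as insertion of lists *)

(** The operation circ for functions of r + 1 and s + 1 arbitrary points, with
    the reversed term of [circ] replaced by minus the direct one.  Keeping [T]
    abstract lets the same formula serve for indices of variables and for
    values in a ring. *)
Definition list_circ (T : Type) (R : pzRingType) r s (F G : seq T -> R) (t : seq T) :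
    R :=
  \sum_(0 <= i < s.+1)
     F (take r.+1 (drop i t)) * G (take i.+1 t ++ drop (i + r).+1 t)
  - \sum_(1 <= i < s.+1)
     F (take r.+1 (drop i t)) * G (take i t ++ drop (i + r) t).

(** f(-y_r, ..., -y_0) = (-1)^(r+1) f(y_0, ..., y_r): on words, reversal with
    the sign (-1)^length is the antipode, which acts as -1 on Lie elements. *)
Definition antipodal r (f : ratfun r) : Prop :=
  at_pt r f true (rev (iota 0 r.+1)) = (-1) ^+ r.+1 * f.

Lemma distinct_iota r : distinct r r (iota 0 r.+1).
Proof.
rewrite /distinct size_iota eqxx iota_uniq; apply/allP => k.
by rewrite mem_iota ltnS => /andP[].
Qed.

Lemma map_nth_iota_id (t : seq nat) n : size t = n ->
  [seq nth 0%N t k | k <- iota 0 n] = t.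
Proof. by move=> <-; rewrite -/(mkseq _ _) mkseq_nth. Qed.

Lemma at_pt_iota r (f : ratfun r) : at_pt r f false (iota 0 r.+1) = f.
Proof.
rewrite /at_pt /tsubst [RHS]frac_repr /rsubst.
have id p : evalp (fun k => point r false (iota 0 r.+1) k.+1 -
    point r false (iota 0 r.+1) 0) p = p%:F.
  rewrite -{2}[p]comp_mpoly_id rmorph_mmap; apply: eq_mmap => // k.
  rewrite [RHS]/= tnth_mktuple /point !nth_iota ?ltnS //= !expr0 !mul1r subr0.
  by rewrite valK.
by congr (_ / _); exact: id.
Qed.

Lemma antipodalP r m (f : ratfun r) e s : antipodal f -> distinct m r s ->
  at_pt m f (~~ e) (rev s) = (-1) ^+ r.+1 * at_pt m f e s.
Proof.
move=> af gs; have /and3P[/eqP sz _ _] := gs.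
have : at_pt m (at_pt r f true (rev (iota 0 r.+1))) e s =
       at_pt m ((-1) ^+ r.+1 * f) e s by rewrite af.
rewrite at_pt_comp ?size_rev ?size_iota ?all_rev //; last first.
  by have /and3P[] := distinct_iota r.
by rewrite addbT map_rev map_nth_iota_id // at_ptM // at_pt_sign.
Qed.

Lemma eq_tsubst r m (f : ratfun r) (y z : nat -> ratfun m) :
  (forall k, (k <= r)%N -> y k = z k) -> tsubst f y = tsubst f z.
Proof. by move=> yz; apply: eq_rsubst => k kr; rewrite !yz // ltnW. Qed.

Section DistinctSublists.
Variables (m r s : nat) (t : seq nat) (gt : distinct m (r + s) t).

Let size_t : size t = (r + s).+1. Proof. by have /and3P[/eqP] := gt. Qed.

Let distinct_subseq t' k : size t' = k.+1 -> subseq t' t -> distinct m k t'.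
Proof.
move=> st' sub; have /and3P[_ ut /allP mt] := gt.
rewrite /distinct st' eqxx (subseq_uniq sub ut).
by apply/allP => k' /(mem_subseq sub)/mt.
Qed.

Lemma distinct_factor i : (i <= s)%N -> distinct m r (take r.+1 (drop i t)).
Proof.
move=> is_; apply: distinct_subseq.
  by rewrite size_take size_drop size_t; case: ifP; lia.
exact: subseq_trans (take_subseq _ _) (drop_subseq _ _).
Qed.

Lemma distinct_cofactor i : (i <= s.+1)%N -> distinct m s (take i t ++ drop (i + r) t).
Proof.
move=> is_; apply: distinct_subseq.
  by rewrite size_cat size_take size_drop size_t; case: ifP; lia.
rewrite -{3}(cat_take_drop i t) cat_subseq // addnC -drop_drop.
exact: drop_subseq.
Qed.

Lemma eq_list_circ (R : pzRingType) (F G F' G' : seq nat -> R) :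
  (forall t', distinct m r t' -> F t' = F' t') ->
  (forall t', distinct m s t' -> G t' = G' t') ->
  list_circ r s F G t = list_circ r s F' G' t.
Proof.
move=> FF GG; rewrite /list_circ; congr (_ - _);
  apply: eq_big_nat => i /andP[_ is_].
  by rewrite FF ?distinct_factor // GG // -addSn distinct_cofactor.
by rewrite FF ?distinct_factor // GG // distinct_cofactor // ltnW.
Qed.

End DistinctSublists.

Section CircList.
Variables r s : nat.
Let I := iota 0 (r + s).+1.
Let gI : distinct (r + s) (r + s) I := distinct_iota (r + s).

Variables (f : ratfun r) (g : ratfun s).

Let nthI j : (j <= r + s)%N -> nth 0%N I j = j.
Proof. by move=> jm; rewrite nth_iota. Qed.

Let factor_nth i k : (i <= s)%N -> (k <= r)%N ->
  nth 0%N (take r.+1 (drop i I)) k = (i + k)%N.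
Proof. by move=> is_ kr; rewrite nth_take // nth_drop nthI //; lia. Qed.

Let cofactor_nth i k : (i <= s.+1)%N -> (k <= s)%N ->
  nth 0%N (take i I ++ drop (i + r) I) k = if (k < i)%N then k else (k + r)%N.
Proof.
move=> is_ ks; rewrite nth_cat size_take size_iota.
have -> : (if (i < (r + s).+1)%N then i else (r + s).+1) = i by case: ifP; lia.
case: ltnP => ki; first by rewrite nth_take // nthI //; lia.
rewrite nth_drop nthI; lia.
Qed.

Lemma circ_at_pt :
  circ f g (r + s) =
  \sum_(0 <= i < s.+1)
     at_pt (r + s) f false (take r.+1 (drop i I))
     * at_pt (r + s) g false (take i.+1 I ++ drop (i + r).+1 I)
  + (-1) ^+ r *
  \sum_(1 <= i < s.+1)
     at_pt (r + s) f true (rev (take r.+1 (drop i I)))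
     * at_pt (r + s) g false (take i I ++ drop (i + r) I).
Proof.
rewrite /circ; congr (_ + _).
  apply: eq_big_nat => i /andP[_ is_]; congr (_ * _); apply: eq_tsubst => k kr.
    by rewrite /point mul1r factor_nth.
  by rewrite /point mul1r -addSn cofactor_nth // ltnS; case: ifP.
congr (_ * _); apply: eq_big_nat => i /andP[i0 is_]; congr (_ * _).
  have /and3P[/eqP sz _ _] := distinct_factor gI is_.
  apply: eq_tsubst => k kr; rewrite /point mulN1r nth_rev ?sz ?ltnS //.
  by rewrite factor_nth //; [congr (- xvar _ _)|]; lia.
apply: eq_tsubst => k kr.
by rewrite /point mul1r cofactor_nth ?(ltnW is_) //; case: ifP.
Qed.

Lemma circE : antipodal f ->
  circ f g (r + s) =
  list_circ r s (at_pt (r + s) f false) (at_pt (r + s) g false) I.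
Proof.
move=> af; rewrite circ_at_pt /list_circ; congr (_ + _).
rewrite mulr_sumr -sumrN; apply: eq_big_nat => i /andP[i0 is_].
rewrite (antipodalP false) ?(distinct_factor gI) // [LHS]mulrA [X in X * _]mulrA.
rewrite -exprD addnS exprS exprD -expr2 sqrr_sign mulr1 mulN1r.
exact: mulNr.
Qed.

(** The form [n = r + s] of the depth makes the lemma applicable to circ f g and
    circ g f at once. *)
Lemma at_pt_circ m n e t : antipodal f -> n = (r + s)%N -> distinct m n t ->
  at_pt m (circ f g n) e t = list_circ r s (at_pt m f e) (at_pt m g e) t.
Proof.
move=> af -> gt; have /and3P[/eqP st _ _] := gt.
have tE : t = [seq nth 0%N t k | k <- I] by rewrite map_nth_iota_id.
rewrite circE // at_ptB // !at_pt_sum // /list_circ; congr (_ - _).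
  apply: eq_big_nat => i /andP[_ is_]; rewrite at_ptM //.
  have /and3P[/eqP s1 _ a1] := distinct_factor gI is_.
  have /and3P[/eqP s2 _ a2] := distinct_cofactor gI (i:=i.+1) is_.
  rewrite -addSn !at_pt_comp // addbF; congr (_ * _); congr at_pt.
    by rewrite {2}tE map_take map_drop.
  by rewrite map_cat map_take map_drop -tE.
apply: eq_big_nat => i /andP[_ is_]; rewrite at_ptM //.
have /and3P[/eqP s1 _ a1] := distinct_factor gI is_.
have /and3P[/eqP s2 _ a2] := distinct_cofactor gI (i:=i) (ltnW is_).
rewrite !at_pt_comp // addbF map_cat !map_take !map_drop -tE //.
Qed.

End CircList.

Lemma distinct_rev m r t : distinct m r (rev t) = distinct m r t.
Proof. by rewrite /distinct size_rev rev_uniq all_rev. Qed.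

Lemma circ_linearl r s n c (f f' : ratfun r) (g : ratfun s) : n = (r + s)%N ->
  circ (cst r c * f + f') g n = cst n c * circ f g n + circ f' g n.
Proof.
move=> ->; have gi := distinct_iota (r + s).
rewrite !circ_at_pt mulrDr addrACA !mulr_sumr -!big_split; congr (_ + _);
  apply: eq_big_nat => i /andP[_ is_]; cbv beta.
  rewrite at_ptD ?(distinct_factor gi) // at_ptM ?(distinct_factor gi) //.
  by rewrite at_pt_cst ?(distinct_factor gi) // mulrDl -mulrA.
have gr : distinct (r + s) r (rev (take r.+1 (drop i (iota 0 (r + s).+1)))).
  by rewrite distinct_rev (distinct_factor gi).
rewrite at_ptD // at_ptM // at_pt_cst // mulrDl mulrDr.
by congr (_ + _); rewrite -[X in _ * X = _]mulrA [LHS]mulrCA.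
Qed.

Lemma circ_linearr r s n c (f : ratfun r) (g g' : ratfun s) : n = (r + s)%N ->
  circ f (cst s c * g + g') n = cst n c * circ f g n + circ f g' n.
Proof.
move=> ->; have gi := distinct_iota (r + s).
rewrite !circ_at_pt mulrDr addrACA !mulr_sumr -!big_split; congr (_ + _);
  apply: eq_big_nat => i /andP[_ is_]; cbv beta.
  have gc := distinct_cofactor gi (i := i.+1) is_.
  by rewrite at_ptD // at_ptM // at_pt_cst // mulrDr mulrCA.
have gc := distinct_cofactor gi (i := i) (ltnW is_).
rewrite at_ptD // at_ptM // at_pt_cst // mulrDr mulrDr.
by congr (_ + _); rewrite [X in _ * X = _]mulrCA [LHS]mulrCA.
Qed.

Section IharaLinear.
Variables r s : nat.

Lemma ihara_linearr c (f : ratfun r) (g g' : ratfun s) :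
  ihara f (cst s c * g + g') = cst (r + s) c * ihara f g + ihara f g'.
Proof.
rewrite /ihara circ_linearr // circ_linearl 1?addnC //.
by rewrite mulrBr opprD addrACA.
Qed.

Lemma ihara_linearl c (f f' : ratfun r) (g : ratfun s) :
  ihara (cst r c * f + f') g = cst (r + s) c * ihara f g + ihara f' g.
Proof.
rewrite /ihara circ_linearl // circ_linearr 1?addnC //.
by rewrite mulrBr opprD addrACA.
Qed.

Lemma ihara0r (f : ratfun r) : ihara f (0 : ratfun s) = 0.
Proof.
have := ihara_linearr (-1) f 0 0.
by rewrite mulr0 addr0 rmorphN1 mulN1r addNr.
Qed.

Lemma ihara0l (g : ratfun s) : ihara (0 : ratfun r) g = 0.
Proof.
have := ihara_linearl (-1) 0 0 g.
by rewrite mulr0 addr0 rmorphN1 mulN1r addNr.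
Qed.

Lemma iharaZr c (f : ratfun r) (g : ratfun s) :
  ihara f (cst s c * g) = cst (r + s) c * ihara f g.
Proof. by rewrite -[cst s c * g]addr0 ihara_linearr ihara0r addr0. Qed.

Lemma iharaDr (f : ratfun r) (g g' : ratfun s) :
  ihara f (g + g') = ihara f g + ihara f g'.
Proof. by rewrite -{1}[g]mul1r -(rmorph1 (@cst s)) ihara_linearr rmorph1 mul1r. Qed.

Lemma iharaDl (f f' : ratfun r) (g : ratfun s) :
  ihara (f + f') g = ihara f g + ihara f' g.
Proof. by rewrite -{1}[f]mul1r -(rmorph1 (@cst r)) ihara_linearl rmorph1 mul1r. Qed.

Lemma iharaZl c (f : ratfun r) (g : ratfun s) :
  ihara (cst r c * f) g = cst (r + s) c * ihara f g.
Proof. by rewrite -[cst r c * f]addr0 ihara_linearl ihara0l addr0. Qed.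

Lemma iharaNl (f : ratfun r) (g : ratfun s) : ihara (- f) g = - ihara f g.
Proof. by apply/eqP; rewrite -addr_eq0 -iharaDl addNr ihara0l. Qed.

Lemma iharaNr (f : ratfun r) (g : ratfun s) : ihara f (- g) = - ihara f g.
Proof. by apply/eqP; rewrite -addr_eq0 -iharaDr addNr ihara0r. Qed.

Lemma ihara_sumr (I : Type) (l : seq I) (P : pred I) (f : ratfun r)
    (G : I -> ratfun s) :
  ihara f (\sum_(i <- l | P i) G i) = \sum_(i <- l | P i) ihara f (G i).
Proof. exact: (big_morph (ihara f) (iharaDr f) (ihara0r f)). Qed.

End IharaLinear.

(** * The Jacobi identity *)

Definition list_br (T : Type) (R : pzRingType) r s (F G : seq T -> R) (t : seq T) : R :=
  list_circ r s F G t - list_circ s r G F t.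

(** Inserting two lists into a third at different places does not depend on the
    order, and the nested insertions cancel; in fixed depths all terms
    are written out and compared. *)
Lemma list_br_jacobi111 (T : Type) (R : comPzRingType) (F G H : seq T -> R) a b c d :
  list_br 1 2 F (list_br 1 1 G H) [:: a; b; c; d] =
  list_br 2 1 (list_br 1 1 F G) H [:: a; b; c; d]
  + list_br 1 2 G (list_br 1 1 F H) [:: a; b; c; d].
Proof. by rewrite /list_br /list_circ unlock /=; ring. Qed.

Lemma list_br_jacobi211 (T : Type) (R : comPzRingType) (F G H : seq T -> R) a b c d e :
  list_br 2 2 F (list_br 1 1 G H) [:: a; b; c; d; e] =
  list_br 3 1 (list_br 2 1 F G) H [:: a; b; c; d; e]
  + list_br 1 3 G (list_br 2 1 F H) [:: a; b; c; d; e].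
Proof. by rewrite /list_br /list_circ unlock /=; ring. Qed.

Lemma eq_list_br m r s (t : seq nat) (R : pzRingType) (F G F' G' : seq nat -> R) :
  distinct m (r + s) t ->
  (forall t', distinct m r t' -> F t' = F' t') ->
  (forall t', distinct m s t' -> G t' = G' t') ->
  list_br r s F G t = list_br r s F' G' t.
Proof.
move=> gt FF GG; rewrite /list_br (eq_list_circ gt FF GG).
by rewrite (eq_list_circ _ GG FF) // addnC.
Qed.

Lemma at_pt_ihara m r s (f : ratfun r) (g : ratfun s) e t :
  antipodal f -> antipodal g -> distinct m (r + s) t ->
  at_pt m (ihara f g) e t = list_br r s (at_pt m f e) (at_pt m g e) t.
Proof.
by move=> af ag gt; rewrite /ihara at_ptB // !at_pt_circ // addnC.
Qed.

Lemma point_diff m e s j :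
  point m e s j - point m e s 0 =
  (-1) ^+ e * (xvar m (nth 0%N s j) - xvar m (nth 0%N s 0)).
Proof. by rewrite /point mulrBr. Qed.

Lemma point_diff0 m s j :
  point m false s j - point m false s 0 =
  xvar m (nth 0%N s j) - xvar m (nth 0%N s 0).
Proof. by rewrite point_diff expr0 mul1r. Qed.

(** In depth 1, (-y_0) - (-y_1) = y_1 - y_0. *)
Lemma antipodal1 (f : ratfun 1) : antipodal f.
Proof.
rewrite /antipodal sqrrN expr1n mul1r -[RHS]at_pt_iota.
apply: eq_rsubst => -[|//] _; rewrite !point_diff /=; ring.
Qed.

(** Reversal exchanges insertion before and after a point, that is the two sums
    of [list_circ], whose index ranges differ by one.  The two boundary terms
    that appear are exchanged with each other when F and G are, so they
    disappear in the bracket. *)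
Lemma list_circ_rev (R : comPzRingType) m r s (F G F' G' : seq nat -> R) (a b : R) t :
  distinct m (r + s) t ->
  (forall u, distinct m r u -> F' (rev u) = a * F u) ->
  (forall u, distinct m s u -> G' (rev u) = b * G u) ->
  list_circ r s F' G' (rev t) =
  a * b * (F (take r.+1 t) * G (drop r t) + F (drop s t) * G (take s.+1 t)
           - list_circ r s F G t).
Proof.
move=> gt FE GE; have /and3P[/eqP st _ _] := gt.
have factorE i : (i <= s)%N ->
    F' (take r.+1 (drop i (rev t))) = a * F (take r.+1 (drop (s - i) t)).
  move=> is_; rewrite -FE ?(distinct_factor gt) ?leq_subr //; congr F'.
  rewrite drop_rev take_rev size_take st take_drop; congr (rev (drop _ (take _ _))).
    by case: ifP; lia.
  lia.
have cofactorE i : (i <= s.+1)%N ->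
    G' (take i (rev t) ++ drop (i + r) (rev t)) =
    b * G (take (s.+1 - i) t ++ drop (s.+1 - i + r) t).
  move=> is_; rewrite -GE ?(distinct_cofactor gt) ?leq_subr //; congr G'.
  rewrite rev_cat take_rev drop_rev st.
  by congr (rev (drop _ _) ++ rev (take _ _)); lia.
pose A i := F (take r.+1 (drop i t)) * G (take i t ++ drop (i + r) t).
pose B i := F (take r.+1 (drop i t)) * G (take i.+1 t ++ drop (i + r).+1 t).
have -> : list_circ r s F' G' (rev t) =
    a * b * (\sum_(0 <= i < s.+1) A i - \sum_(0 <= i < s) B i).
  rewrite /list_circ mulrBr !mulr_sumr; congr (_ - _).
    rewrite big_nat_rev; apply: eq_big_nat => i /andP[_ is_].
    rewrite add0n subSS factorE ?leq_subr // -addSn cofactorE; last by lia.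
    have -> : (s.+1 - (s - i).+1 = i)%N by lia.
    by rewrite subKn // mulrACA.
  rewrite big_nat_rev big_add1; apply: eq_big_nat => i /andP[_ is_].
  rewrite factorE ?cofactorE; [|lia|lia].
  have -> : (s - (1 + s.+1 - i.+2) = i)%N by lia.
  have -> : (s.+1 - (1 + s.+1 - i.+2) = i.+1)%N by lia.
  by rewrite mulrACA.
have -> : list_circ r s F G t =
    \sum_(0 <= i < s.+1) B i - \sum_(1 <= i < s.+1) A i by [].
rewrite [\sum_(0 <= i < s.+1) B i]big_nat_recr // [\sum_(0 <= i < s.+1) A i]big_ltn //=.
have -> : A 0%N = F (take r.+1 t) * G (drop r t).
  by rewrite /A drop0 take0 cat0s add0n.
have -> : B s = F (drop s t) * G (take s.+1 t).
  rewrite /B (drop_oversize (n := (s + r).+1)) ?st 1?addnC // cats0.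
  by rewrite take_oversize // size_drop st; lia.
ring.
Qed.

Lemma antipodal_ihara r s (f : ratfun r) (g : ratfun s) :
  antipodal f -> antipodal g -> antipodal (ihara f g).
Proof.
move=> af ag; rewrite /antipodal -[X in _ = _ * X]at_pt_iota.
have gi := distinct_iota (r + s); move: (iota _ _) gi => t gt.
have grt : distinct (r + s) (r + s) (rev t).
  by rewrite distinct_rev.
rewrite !at_pt_ihara // /list_br.
have FE u : distinct (r + s) r u -> at_pt (r + s) f true (rev u) =
    (-1) ^+ r.+1 * at_pt (r + s) f false u.
  exact: (antipodalP false).
have GE u : distinct (r + s) s u -> at_pt (r + s) g true (rev u) =
    (-1) ^+ s.+1 * at_pt (r + s) g false u.
  exact: (antipodalP false).
rewrite (list_circ_rev gt FE GE) (list_circ_rev _ GE FE); last by rewrite (addnC s).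
rewrite [in RHS]exprS exprD !exprS.
ring.
Qed.

Lemma ihara_jacobi111 (f g h : ratfun 1) :
  ihara f (ihara g h) =
  ihara (ihara f g) h + ihara g (ihara f h) :> ratfun 3.
Proof.
have a1 := antipodal1.
have a11 (f' g' : ratfun 1) := antipodal_ihara (a1 f') (a1 g').
have g3 : distinct 3 3 (iota 0 4) by [].
rewrite -[LHS]at_pt_iota -[RHS]at_pt_iota at_ptD //.
rewrite (@at_pt_ihara 3 1 2) // (@at_pt_ihara 3 2 1) // (@at_pt_ihara 3 1 2) //.
have e11 (f' g' : ratfun 1) t' : distinct 3 2 t' -> at_pt 3 (ihara f' g') false t' =
    list_br 1 1 (at_pt 3 f' false) (at_pt 3 g' false) t'.
  by move=> gt'; exact: at_pt_ihara.
rewrite (eq_list_br (r:=1) (s:=2) g3 (fun _ _ => erefl) (@e11 _ _)).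
rewrite (eq_list_br (r:=2) (s:=1) g3 (@e11 _ _) (fun _ _ => erefl)).
rewrite (eq_list_br (r:=1) (s:=2) g3 (fun _ _ => erefl) (@e11 _ _)).
exact: list_br_jacobi111.
Qed.

Lemma ihara_jacobi211 (f : ratfun 2) (g h : ratfun 1) : antipodal f ->
  ihara f (ihara g h) =
  ihara (ihara f g) h + ihara g (ihara f h) :> ratfun 4.
Proof.
move=> af; have a1 := antipodal1.
have a11 (f' g' : ratfun 1) := antipodal_ihara (a1 f') (a1 g').
have a21 (g' : ratfun 1) := antipodal_ihara af (a1 g').
have g4 : distinct 4 4 (iota 0 5) by [].
rewrite -[LHS]at_pt_iota -[RHS]at_pt_iota at_ptD //.
rewrite (@at_pt_ihara 4 2 2) // (@at_pt_ihara 4 3 1) // (@at_pt_ihara 4 1 3) //.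
have e11 (f' g' : ratfun 1) t' : distinct 4 2 t' -> at_pt 4 (ihara f' g') false t' =
    list_br 1 1 (at_pt 4 f' false) (at_pt 4 g' false) t'.
  by move=> gt'; exact: at_pt_ihara.
have e21 (g' : ratfun 1) t' : distinct 4 3 t' -> at_pt 4 (ihara f g') false t' =
    list_br 2 1 (at_pt 4 f false) (at_pt 4 g' false) t'.
  by move=> gt'; exact: at_pt_ihara.
rewrite (eq_list_br (r:=2) (s:=2) g4 (fun _ _ => erefl) (@e11 _ _)).
rewrite (eq_list_br (r:=3) (s:=1) g4 (@e21 _) (fun _ _ => erefl)).
rewrite (eq_list_br (r:=1) (s:=3) g4 (fun _ _ => erefl) (@e21 _)).
exact: list_br_jacobi211.
Qed.

(** Both sides have the same depth as numbers, but the types [ratfun (r + s)]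
    and [ratfun (s + r)] only agree by conversion, for concrete r and s. *)
Lemma ihara13_antisym (f : ratfun 1) (g : ratfun 3) :
  ihara g f = - ihara f g :> ratfun 4.
Proof. exact: (esym (opprB _ _)). Qed.

Lemma ihara12_antisym (f : ratfun 1) (g : ratfun 2) :
  ihara g f = - ihara f g :> ratfun 3.
Proof. exact: (esym (opprB _ _)). Qed.

Lemma ihara22_antisym (f g : ratfun 2) : ihara g f = - ihara f g :> ratfun 4.
Proof. exact: (esym (opprB _ _)). Qed.

(** The other positions of the argument of depth 2 follow from
    [ihara_jacobi211] by antisymmetry. *)
Lemma ihara_jacobi121 (f h : ratfun 1) (g : ratfun 2) : antipodal g ->
  ihara f (ihara g h) =
  ihara (ihara f g) h + ihara g (ihara f h) :> ratfun 4.
Proof.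
move=> ag; rewrite [ihara g (ihara f h)]ihara_jacobi211 //.
rewrite (ihara12_antisym f g).
have -> : ihara (- ihara f g) h = - ihara (ihara f g) h by exact: iharaNl.
by rewrite addNKr.
Qed.

Lemma ihara_jacobi112 (f g : ratfun 1) (h : ratfun 2) : antipodal h ->
  ihara f (ihara g h) =
  ihara (ihara f g) h + ihara g (ihara f h) :> ratfun 4.
Proof.
move=> ah; have := ihara_jacobi121 f g ah.
rewrite (ihara12_antisym g h) (ihara22_antisym (ihara f g) h).
have -> : ihara f (- ihara g h) = - ihara f (ihara g h) by exact: iharaNr.
rewrite (ihara13_antisym g (ihara f h)).
by move/eqP; rewrite eqr_oppLR opprD !opprK => /eqP ->; rewrite addrC.
Qed.

(** * The functions s1, s2 and z3 *)

Lemma xvar_sub_neq0 m j k : (j <= m)%N -> (k <= m)%N -> j != k ->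
  xvar m j - xvar m k != 0.
Proof.
move=> jm km jk; rewrite !xvar_tofrac -tofracB tofrac_eq0.
pose v (i : 'I_m) : rat := (i.+1 == j)%:R - (i.+1 == k)%:R.
have vE l : (l <= m)%N -> (xpoly m l).@[v] = (l == j)%:R - (l == k)%:R -
   (if l is 0 then (0%N == j)%:R - (0%N == k)%:R else 0).
  case: l => [|l] lm; first by rewrite /= meval0 subrr.
  by rewrite (xpolyS (Ordinal lm)) mevalXU subr0.
apply/eqP => /(congr1 (meval v)); rewrite mevalB meval0 !vE // !eqxx.
rewrite [k == j]eq_sym (negPf jk).
by case: j k jk {jm km v vE} => [|j] [|k].
Qed.

Section AtPointPoles.
Variables (m : nat) (t : seq nat).
Let x k := xvar m (nth 0%N t k).

Lemma at_pt_s1 : distinct m 1 t -> at_pt m s1 false t = (2%:R * (x 1 - x 0))^-1.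
Proof.
by move=> gt; rewrite /s1 at_ptV // at_ptM // at_pt_nat // at_pt_xvar // point_diff0.
Qed.

Lemma at_pt_mon e : distinct m 1 t -> at_pt m (mon e) false t = (x 1 - x 0) ^ e.
Proof.
move=> gt; have <- : at_pt m (xvar 1 1) false t = x 1 - x 0.
  by rewrite at_pt_xvar // point_diff0.
exact: at_pt_exprz gt _ _.
Qed.

(** The sign [e] is irrelevant because s2 is homogeneous of even degree. *)
Lemma at_pt_s2 e : distinct m 2 t ->
  at_pt m s2 e t =
  cst m 12%:R^-1 * (((x 1 - x 0) * (x 2 - x 0))^-1
                    + ((x 2 - x 0) * (x 1 - x 2))^-1).
Proof.
move=> gt; rewrite /s2 at_ptM // at_pt_cst // at_ptD // !at_ptV // !at_ptM //.
rewrite at_ptB // !at_pt_xvar // !point_diff -!/(x _).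
move: (x 0) (x 1) (x 2) (cst m _) => x0 x1 x2 u.
have sgn v w : (-1) ^+ e * v * ((-1) ^+ e * w) = v * w :> ratfun m.
  by rewrite mulrACA -expr2 sqrr_sign mul1r.
by rewrite -mulrBr !sgn opprB addrA subrK.
Qed.

End AtPointPoles.

Fact s2_antipodal_identity (F : fieldType) (c x y z : F) :
  y - x != 0 -> z - x != 0 -> y - z != 0 ->
  c * (((y - z) * (x - z))^-1 + ((x - z) * (y - x))^-1) =
  - (c * (((y - x) * (z - x))^-1 + ((z - x) * (y - z))^-1)).
Proof. by move=> h1 h2 h3; field; rewrite h1 h2 h3 -opprB oppr_eq0 h2. Qed.

Lemma antipodal_s2 : antipodal s2.
Proof.
rewrite /antipodal -[X in _ = _ * X]at_pt_iota !at_pt_s2 //.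
rewrite -signr_odd expr1 mulN1r.
by apply: s2_antipodal_identity; apply: xvar_sub_neq0.
Qed.

(** The functions s1, s2, x_1^2 are replaced by their values, so that the
    identity is one of rational expressions in three elements of a field. *)
Fact z3_identity (F : fieldType) (x : nat -> F) (S1 S2 M : seq nat -> F) :
  (forall j k, (j <= 3)%N -> (k <= 3)%N -> j != k -> x j - x k != 0) ->
  x 0 = 0 -> 2%:R != 0 :> F -> 3%:R != 0 :> F ->
  (forall t, S1 t = (2%:R * (x (nth 0%N t 1) - x (nth 0%N t 0)))^-1) ->
  (forall t, S2 t = (12%:R)^-1 *
     (((x (nth 0%N t 1) - x (nth 0%N t 0)) * (x (nth 0%N t 2) - x (nth 0%N t 0)))^-1
     + ((x (nth 0%N t 2) - x (nth 0%N t 0)) * (x (nth 0%N t 1) - x (nth 0%N t 2)))^-1)) ->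
  (forall t, M t = (x (nth 0%N t 1) - x (nth 0%N t 0)) ^+ 2) ->
  list_br 2 1 S2 M (iota 0 4) + 2%:R^-1 * list_br 1 2 S1 (list_br 1 1 S1 M) (iota 0 4) =
  3%:R / 12%:R * (4%:R / 3%:R + x 1 / (x 3 - x 2) + x 3 / (x 1 - x 2)
  + (x 3 - x 2) / x 1 + (x 1 - x 2) / x 3).
Proof.
move=> xne x0 two three S1E S2E ME; rewrite /list_br /list_circ unlock /= !S1E !S2E !ME /=.
have := (xne 1 0 isT isT isT, xne 2 0 isT isT isT, xne 3 0 isT isT isT).
have := (xne 1 2 isT isT isT, xne 1 3 isT isT isT, xne 2 3 isT isT isT).
rewrite x0 !subr0; move: (x 1) (x 2) (x 3) => a b c [[ab ac] bc] [[a0 b0] c0].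
have twelve : 12%:R != 0 :> F.
  by rewrite (_ : 12%N = (2 * 2 * 3)%N) // !natrM !mulf_neq0.
have opp (u v : F) : u - v != 0 -> v - u != 0 by rewrite -opprB oppr_eq0.
by field; rewrite c0 a0 ab (opp _ _ bc) three twelve two (opp _ _ ac) (opp _ _ ab) b0 ac bc.
Qed.

Lemma xi3_1 : xi3 1 = cst 3 (3%:R / 12%:R) * z3.
Proof.
have a1 := antipodal1; have as2 := antipodal_s2.
have a11 (f' g' : ratfun 1) := antipodal_ihara (a1 f') (a1 g').
have g3 : distinct 3 3 (iota 0 4) by [].
pose x := xvar 3.
pose S1 (t : seq nat) := (2%:R * (x (nth 0%N t 1) - x (nth 0%N t 0)))^-1.
pose S2 (t : seq nat) := 12%:R^-1 *
  (((x (nth 0%N t 1) - x (nth 0%N t 0)) * (x (nth 0%N t 2) - x (nth 0%N t 0)))^-1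
  + ((x (nth 0%N t 2) - x (nth 0%N t 0)) * (x (nth 0%N t 1) - x (nth 0%N t 2)))^-1).
pose M (t : seq nat) := (x (nth 0%N t 1) - x (nth 0%N t 0)) ^+ 2.
have cst_nat n : cst 3 n%:R = n%:R by exact: rmorph_nat.
have cstV c : cst 3 c^-1 = (cst 3 c)^-1 by exact: fmorphV.
have cstM c d : cst 3 (c * d) = cst 3 c * cst 3 d by exact: rmorphM.
have S1E t : distinct 3 1 t -> at_pt 3 s1 false t = S1 t by exact: at_pt_s1.
have S2E t : distinct 3 2 t -> at_pt 3 s2 false t = S2 t.
  by move=> gt; rewrite at_pt_s2 // cstV cst_nat.
have ME t : distinct 3 1 t -> at_pt 3 (mon (2 * 1)%N) false t = M t.
  by move=> gt; rewrite at_pt_mon.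
rewrite -[LHS]at_pt_iota /xi3 at_ptD // at_ptM // at_pt_cst //.
rewrite (@at_pt_ihara 3 2 1) // (@at_pt_ihara 3 1 2) //.
rewrite (eq_list_br (r := 2) (s := 1) g3 S2E ME).
have LE t : distinct 3 2 t ->
    at_pt 3 (ihara s1 (mon (2 * 1)%N)) false t = list_br 1 1 S1 M t.
  by move=> gt; rewrite at_pt_ihara //; exact: (eq_list_br (r := 1) (s := 1) gt S1E ME).
rewrite (eq_list_br (r := 1) (s := 2) g3 S1E LE).
rewrite /z3 !cstM !cstV !cst_nat.
apply: z3_identity => //; first exact: xvar_sub_neq0.
all: by rewrite -cst_nat fmorph_eq0.
Qed.

(** * Words and their depth components *)

Definition word1 (w : word) : ncpoly := monalg.mkmalgU w 1.

Lemma depth_cat u v : depth (u ++ v) = (depth u + depth v)%N.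
Proof. exact: count_cat. Qed.

Lemma mkmalgU_word1 (w : word) (c : rat) : monalg.mkmalgU w c = c *: word1 w.
Proof.
apply/monalg.malgP => w'.
rewrite [RHS]monalg.mcoeffZ [LHS]monalg.mcoeffU /word1 monalg.mcoeffU.
by case: eqP => _; rewrite ?mulr1n ?mulr0n ?mulr1 ?mulr0.
Qed.

Section WordValue.
Variables (K : comNzRingType) (io : {rmorphism rat -> K}).
Implicit Types (y t : seq K) (a b : ncpoly).

(** A letter x0 contributes the current point and a letter x1 moves on to the
    next point: this is y_0^i_0 ... y_r^i_r for the word
    x0^i_0 x1 ... x1 x0^i_r. *)
Fixpoint word_val y (w : seq bool) : K :=
  match w with
  | [::] => 1
  | false :: w' => head 0 y * word_val y w'
  | true :: w' => word_val (behead y) w'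
  end.

Definition lin (h : word -> K) (a : ncpoly) : K :=
  \sum_(w <- monalg.msupp a) io (monalg.mcoeff w a) * h w.

Lemma linE (d : {fset word}) h a : (monalg.msupp a `<=` d)%fset ->
  lin h a = \sum_(w <- d) io (monalg.mcoeff w a) * h w.
Proof.
move=> ad; apply: big_fset_incl => // w _ /monalg.mcoeff_outdom ->.
by rewrite rmorph0 mul0r.
Qed.

Lemma linD h a b : lin h (a + b) = lin h a + lin h b.
Proof.
rewrite (linE h (monalg.msuppD_le a b)) (linE h (fsubsetUl _ (monalg.msupp b))).
rewrite (linE h (fsubsetUr (monalg.msupp a) _)) -big_split /=.
by apply: eq_bigr => w _; rewrite monalg.mcoeffD rmorphD mulrDl.
Qed.

Lemma linZ h c a : lin h (c *: a) = io c * lin h a.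
Proof.
rewrite (linE h (monalg.msuppZ_le c a)) /lin mulr_sumr.
by apply: eq_bigr => w _; rewrite monalg.mcoeffZ rmorphM mulrA.
Qed.

Lemma lin_word h (w : word) : lin h (word1 w) = h w.
Proof.
rewrite (linE h (d := [fset w]%fset)) ?monalg.msuppU_le //.
by rewrite big_seq_fset1 monalg.mcoeffUU rmorph1 mul1r.
Qed.

(** The value at [y] of the polynomial of the depth [r] part.  The coefficient
    ring is arbitrary: fields of rational functions are needed for brackets,
    and a polynomial ring to recover the coefficients of an element from its
    reduced form ([depth_geS]). *)
Definition depth_val (r : nat) (a : ncpoly) y : K :=
  lin (fun w => if depth w == r then word_val y w else 0) a.

Lemma depth_valD r a b y : depth_val r (a + b) y = depth_val r a y + depth_val r b y.
Proof. exact: linD. Qed.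
Lemma depth_valZ r c a y : depth_val r (c *: a) y = io c * depth_val r a y.
Proof. exact: linZ. Qed.
Lemma depth_valN r a y : depth_val r (- a) y = - depth_val r a y.
Proof. by rewrite -scaleN1r depth_valZ rmorphN1 mulN1r. Qed.
Lemma depth_valB r a b y : depth_val r (a - b) y = depth_val r a y - depth_val r b y.
Proof. by rewrite depth_valD depth_valN. Qed.
Lemma depth_val0 r y : depth_val r 0 y = 0.
Proof. by rewrite -[0](scale0r 0) depth_valZ rmorph0 mul0r. Qed.
Lemma depth_val_sum r (I : Type) (l : seq I) (P : pred I) (F : I -> ncpoly) y :
  depth_val r (\sum_(i <- l | P i) F i) y = \sum_(i <- l | P i) depth_val r (F i) y.
Proof.
exact: (big_morph (fun a => depth_val r a y) (fun a b => depth_valD r a b y)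
  (depth_val0 r y)).
Qed.
Lemma depth_val_word r (w : word) y :
  depth_val r (word1 w) y = if depth w == r then word_val y w else 0.
Proof. exact: lin_word. Qed.

Lemma depth_val_expand r a y :
  depth_val r a y = \sum_(w <- monalg.msupp a)
    io (monalg.mcoeff w a) * depth_val r (word1 w) y.
Proof. by apply: eq_bigr => w _; rewrite depth_val_word. Qed.

Lemma word_val_cat y (u v : seq bool) :
  word_val y (u ++ v) = word_val y u * word_val (drop (depth u) y) v.
Proof.
elim: u y => [|[] u IH] y /=; first by rewrite drop0 mul1r.
  by rewrite IH -drop1 drop_drop addn1.
by rewrite IH mulrA.
Qed.

Lemma word_val_take y w : word_val (take (depth w).+1 y) w = word_val y w.
Proof.
elim: w y => [|[] w IH] [|x y] //=.
by rewrite -[in RHS]IH.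
Qed.

Lemma depth_val_take r a y : depth_val r a (take r.+1 y) = depth_val r a y.
Proof.
apply: eq_bigr => w _; case: eqP => // <-.
by rewrite word_val_take.
Qed.

Lemma word1M (u v : word) : word1 u * word1 v = word1 (monalg.mul u v).
Proof. by rewrite monalg.malgM_def monalg.fgmulUU mulr1. Qed.

(** Concatenation of words: the second factor starts at the point reached by the
    first one. *)
Lemma depth_valM m a b y :
  depth_val m (a * b) y =
  \sum_(0 <= r < m.+1) depth_val r a y * depth_val (m - r) b (drop r y).
Proof.
have -> : a * b = \sum_(u <- monalg.msupp a) \sum_(v <- monalg.msupp b)
    (monalg.mcoeff u a * monalg.mcoeff v b) *: word1 (monalg.mul u v).
  rewrite monalg.malgME; apply: eq_bigr => u _; apply: eq_bigr => v _.
  exact: mkmalgU_word1.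
rewrite depth_val_sum.
under eq_bigr => u _ do rewrite depth_val_sum.
under [RHS]eq_bigr => r _ do rewrite /depth_val /lin big_distrlr /=.
rewrite [RHS]exchange_big /=; apply: eq_bigr => u _.
rewrite [RHS]exchange_big /=; apply: eq_bigr => v _.
rewrite depth_valZ depth_val_word rmorphM.
have -> : (monalg.mul u v : seq bool) = u ++ v :> seq bool by exact: monalg.fmM.
rewrite depth_cat word_val_cat.
transitivity (\sum_(0 <= r < m.+1 | r == depth u)
   io (monalg.mcoeff u a) * word_val y u *
   (io (monalg.mcoeff v b) *
     (if depth v == (m - r)%N then word_val (drop r y) v else 0))); last first.
  rewrite big_mkcond; apply: eq_bigr => r _.
  by rewrite eq_sym; case: eqP => // _; rewrite mulr0 mul0r.
rewrite big_nat1_eq /= ltnS; case: leqP => um; last first.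
  by rewrite ifF ?mulr0 //; apply/eqP; lia.
have -> : (depth v == m - depth u)%N = (depth u + depth v == m)%N.
  by apply/eqP/eqP; lia.
case: eqP => _; last by rewrite !mulr0.
by rewrite mulrACA.
Qed.

(** * The Ihara action in terms of depth components *)

Lemma list_circ_sum (T : Type) (L : Type) (l : seq L) r s (F : seq T -> K)
    (c : L -> K) (G : L -> seq T -> K) (t : seq T) :
  list_circ r s F (fun u => \sum_(i <- l) c i * G i u) t =
  \sum_(i <- l) c i * list_circ r s F (G i) t.
Proof.
under [RHS]eq_bigr => i _ do rewrite /list_circ mulrBr !mulr_sumr.
rewrite sumrB exchange_big /= [X in _ = _ - X]exchange_big /= /list_circ.
by congr (_ - _); apply: eq_bigr => k _; rewrite mulr_sumr;
  apply: eq_bigr => i _; rewrite mulrCA.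
Qed.

End WordValue.

Section IharaAction.

Lemma prod_letter (w : seq bool) :
  \prod_(k <- w) letter k = word1 (monalg.FMonom w).
Proof.
elim: w => [|l w IH].
  by rewrite big_nil /word1 -monalg.fmoneE.
rewrite big_cons IH /letter -/(word1 _) word1M; congr word1.
by apply/eqP; rewrite monalg.fmP monalg.fmM monalg.fmU.
Qed.

Variables (K : comNzRingType) (io : {rmorphism rat -> K}).
Implicit Types (y t : seq K) (a b : ncpoly).
Notation depth_val := (depth_val io).

Lemma depth_val_letterM_x0 m b y :
  depth_val m (letter false * b) y = head 0 y * depth_val m b y.
Proof.
rewrite depth_valM big_ltn // big1_seq => [|r]; last first.
  rewrite mem_index_iota => /andP[_ /andP[r0 _]].
  by rewrite /letter -/(word1 _) depth_val_word monalg.fmU /= ifF ?mul0r //; apply/eqP; lia.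
by rewrite /letter -/(word1 _) depth_val_word monalg.fmU /= mulr1 addr0 subn0 drop0.
Qed.

Lemma depth_val_letterM_x1 m b y :
  depth_val m.+1 (letter true * b) y = depth_val m b (behead y).
Proof.
rewrite depth_valM big_ltn // big_ltn // big1_seq => [|r]; last first.
  rewrite mem_index_iota => /andP[_ /andP[r0 _]].
  by rewrite /letter -/(word1 _) depth_val_word monalg.fmU /= ifF ?mul0r //; apply/eqP; lia.
rewrite /letter -/(word1 _) !depth_val_word monalg.fmU /= mul0r add0r addr0 mul1r.
by rewrite subn1 drop1.
Qed.

Lemma depth_val_letterM_x1_0 b y : depth_val 0 (letter true * b) y = 0.
Proof.
by rewrite depth_valM big_nat1 /letter -/(word1 _) depth_val_word monalg.fmU mul0r.
Qed.

(** The action of [a] on the word [w] as an element of the path torsor. *)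
Definition act_word (a : ncpoly) (w : seq bool) : ncpoly :=
  ihara_der_word a w + (\prod_(k <- w) letter k) * a.

Lemma act_word_x0 a w : act_word a (false :: w) = letter false * act_word a w.
Proof. by rewrite /act_word /= mul0r add0r big_cons mulrDr mulrA. Qed.

Fact insert_x1_identity (R : pzRingType) (a x p d : R) :
  (a * x - x * a) * p + x * d + x * p * a =
  a * (x * p) + x * (d + p * a) - x * (a * p).
Proof.
rewrite mulrBl mulrDr !mulrA addrA [RHS]addrAC.
congr (_ + _); exact: addrAC.
Qed.

Lemma act_word_x1 a w : act_word a (true :: w) =
  a * (letter true * \prod_(k <- w) letter k) + letter true * act_word a w
  - letter true * (a * \prod_(k <- w) letter k).
Proof.
rewrite /act_word /= big_cons /lie_br.
exact: insert_x1_identity.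
Qed.

Lemma list_circ0r r s (F : seq K -> K) t : list_circ r s F (fun=> 0) t = 0.
Proof. by rewrite /list_circ !big1 ?subr0 // => i _; rewrite mulr0. Qed.

Lemma eq_list_circr r s (F G G' : seq K -> K) t : G =1 G' ->
  list_circ r s F G t = list_circ r s F G' t.
Proof. by move=> GG; congr (_ - _); apply: eq_bigr => i _; rewrite GG. Qed.

Lemma list_circ_x0 r s (F G : seq K -> K) t : (0 < size t)%N ->
  list_circ r s F (fun u => head 0 u * G u) t = head 0 t * list_circ r s F G t.
Proof.
case: t => [//|x t] _; rewrite /list_circ mulrBr !mulr_sumr; congr (_ - _).
  by apply: eq_big_nat => i _; rewrite mulrCA.
by apply: eq_big_nat => -[|i] // _; rewrite mulrCA.
Qed.

(** When G is the value of a word that starts with x1, the three ways of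
    treating this letter: insertion just before it, further to the right, and
    just after it. *)
Lemma list_circ_x1 r s (F G : seq K -> K) t : (0 < size t)%N ->
  list_circ r s.+1 F (fun u => G (behead u)) t =
  F (take r.+1 t) * G (drop r.+1 t) + list_circ r s F G (behead t)
  - F (take r.+1 (behead t)) * G (drop r (behead t)).
Proof.
case: t => [//|x t] _; rewrite /list_circ.
rewrite big_ltn // big_add1 /= [X in _ - X]big_ltn // [X in _ - (_ + X)]big_add1 /=.
rewrite take0 drop0 add0n opprD [- _ - _]addrC !addrA; congr (_ - _).
Qed.

Lemma depth_val_x0 s w t : depth_val s (word1 (monalg.FMonom (false :: w))) t =
  head 0 t * depth_val s (word1 (monalg.FMonom w)) t.
Proof. by rewrite !depth_val_word /=; case: ifP; rewrite ?mulr0. Qed.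

Lemma depth_val_x1_0 w t : depth_val 0 (word1 (monalg.FMonom (true :: w))) t = 0.
Proof. by rewrite depth_val_word. Qed.

Lemma depth_val_x1 s w t : depth_val s.+1 (word1 (monalg.FMonom (true :: w))) t =
  depth_val s (word1 (monalg.FMonom w)) (behead t).
Proof. by rewrite !depth_val_word. Qed.

(** The right-hand side of [act_word_x1]: the first and last terms are the two
    insertions next to the letter x1. *)
Lemma depth_val_x1_commutator m a b c t :
  depth_val m.+1 (a * (letter true * b) + letter true * c - letter true * (a * b)) t =
  \sum_(0 <= r < m.+1) (depth_val r a t * depth_val (m - r) b (drop r.+1 t)
    - depth_val r a (behead t) * depth_val (m - r) b (drop r (behead t)))
  + depth_val m c (behead t).
Proof.
rewrite depth_valB depth_valD sumrB addrAC; congr (_ - _ + _).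
- rewrite depth_valM big_nat_recr //= subnn depth_val_letterM_x1_0 mulr0 addr0.
  apply: eq_big_nat => r /andP[_ rm].
  by rewrite subSn // depth_val_letterM_x1 -drop1 drop_drop add1n.
- by rewrite depth_val_letterM_x1 depth_valM.
exact: depth_val_letterM_x1.
Qed.

Lemma depth_val_x1_commutator0 a b c t :
  depth_val 0 (a * (letter true * b) + letter true * c - letter true * (a * b)) t = 0.
Proof.
transitivity (0 + 0 - 0 : K); last by rewrite addr0 subr0.
rewrite depth_valB depth_valD; congr (_ + _ - _); try exact: depth_val_letterM_x1_0.
by rewrite depth_valM big_nat1 depth_val_letterM_x1_0 mulr0.
Qed.

(** Inserting [a] at all places of a word is [list_circ], by induction on the
    word. *)
Lemma depth_val_act_word m a w t : size t = m.+1 ->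
  depth_val m (act_word a w) t =
  \sum_(0 <= r < m.+1)
    list_circ r (m - r) (depth_val r a) (depth_val (m - r) (word1 (monalg.FMonom w))) t.
Proof.
elim: w m t => [|[] w IH] m t st.
- rewrite /act_word big_nil mul1r add0r big_nat_recr //= big1_seq ?add0r => [|r].
    rewrite subnn /list_circ big_nat1 big_geq // subr0 depth_val_word mulr1.
    by rewrite drop0 depth_val_take.
  rewrite mem_index_iota => /andP[_ rm].
  rewrite (eq_list_circr _ _ _ (G' := fun=> 0)) ?list_circ0r // => u.
  by rewrite depth_val_word ifF //; apply/eqP => /=; lia.
- rewrite act_word_x1 prod_letter; case: m st => [|m] st.
    rewrite depth_val_x1_commutator0 big_nat1.
    by rewrite subnn (eq_list_circr _ _ _ _ (G' := fun=> 0) (depth_val_x1_0 _)) list_circ0r.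
  rewrite depth_val_x1_commutator IH ?size_behead ?st // -big_split.
  rewrite [RHS]big_nat_recr //= subnn
    [X in _ = _ + X](eq_list_circr _ _ _ _ (G' := fun=> 0) (depth_val_x1_0 _)).
  rewrite list_circ0r addr0; apply: eq_big_nat => r /andP[_ rm].
  rewrite subSn // (eq_list_circr _ _ _ _ (depth_val_x1 _ _)) list_circ_x1 ?st //.
  by rewrite !depth_val_take addrAC.
rewrite act_word_x0 depth_val_letterM_x0 IH // mulr_sumr.
apply: eq_bigr => r _; rewrite -list_circ_x0 ?st //.
exact/esym/eq_list_circr/depth_val_x0.
Qed.

(** By linearity in [b], the polynomial formula for a o b. *)
Lemma depth_val_action m a b t : size t = m.+1 ->
  depth_val m (ihara_der a b + b * a) t =
  \sum_(0 <= r < m.+1) list_circ r (m - r) (depth_val r a) (depth_val (m - r) b) t.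
Proof.
move=> st; pose c w := io (monalg.mcoeff w b).
transitivity (\sum_(w <- monalg.msupp b) c w * depth_val m (act_word a w) t).
  have derE : depth_val m (ihara_der a b) t =
      \sum_(w <- monalg.msupp b) c w * depth_val m (ihara_der_word a w) t.
    by rewrite depth_val_sum; apply: eq_bigr => w _; rewrite depth_valZ.
  have mulE : depth_val m (b * a) t =
      \sum_(w <- monalg.msupp b) c w * depth_val m (word1 w * a) t.
    transitivity (\sum_(0 <= r < m.+1) \sum_(w <- monalg.msupp b)
        c w * (depth_val r (word1 w) t * depth_val (m - r) a (drop r t))).
      rewrite depth_valM; apply: eq_bigr => r _.
      rewrite [depth_val r b t]depth_val_expand mulr_suml.
      by apply: eq_bigr => w _; rewrite mulrA.
    by rewrite exchange_big; apply: eq_bigr => w _; rewrite depth_valM mulr_sumr.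
  transitivity (depth_val m (ihara_der a b) t + depth_val m (b * a) t).
    exact: depth_valD.
  rewrite derE mulE -big_split; apply: eq_bigr => -[w] _ /=.
  by rewrite -mulrDr -depth_valD -prod_letter.
under eq_bigr => w _ do rewrite depth_val_act_word // mulr_sumr.
rewrite exchange_big; apply: eq_bigr => r _ /=.
rewrite (eq_list_circr _ _ _ _ (depth_val_expand _ _ _)) list_circ_sum.
by apply: eq_bigr => -[w].
Qed.

Lemma depth_val_ihara_nc m a b t : size t = m.+1 ->
  depth_val m (ihara_nc a b) t =
  \sum_(0 <= r < m.+1) list_br r (m - r) (depth_val r a) (depth_val (m - r) b) t.
Proof.
move=> st; transitivity
    (\sum_(0 <= r < m.+1) list_circ r (m - r) (depth_val r a) (depth_val (m - r) b) t
     - \sum_(0 <= r < m.+1) list_circ r (m - r) (depth_val r b) (depth_val (m - r) a) t).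
  by rewrite depth_valB; congr (_ - _); exact: depth_val_action.
rewrite [X in _ - X]big_nat_rev -sumrB; apply: eq_big_nat => r /andP[_ rm].
by rewrite add0n subSS subKn.
Qed.

End IharaAction.

(** * Lie elements *)

Section LieElements.
Variables (K : comNzRingType) (io : {rmorphism rat -> K}).
Implicit Types (y t : seq K) (a b : ncpoly).
Notation depth_val := (depth_val io).

Lemma depth_val_letter r l y :
  depth_val r (letter l) y = if nat_of_bool l == r then word_val y [:: l] else 0.
Proof.
rewrite /letter -/(word1 _) depth_val_word !monalg.fmU /depth /= addn0.
by case: l.
Qed.

Lemma depth_val_lie_br m a b y :
  depth_val m (lie_br a b) y =
  \sum_(0 <= r < m.+1) depth_val r a y * depth_val (m - r) b (drop r y)
  - \sum_(0 <= r < m.+1) depth_val r b y * depth_val (m - r) a (drop r y).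
Proof. by rewrite depth_valB; congr (_ - _); exact: depth_valM. Qed.

(** How the exceptional terms of depth 0 enter a product; they are symmetric in
    the two factors and cancel in a commutator. *)
Fact sum_perturb m (A B : nat -> K) p q :
  \sum_(0 <= r < m.+1) (A r + (r == 0%N)%:R * p) * (B r + ((m - r)%N == 0%N)%:R * q) =
  \sum_(0 <= r < m.+1) A r * B r + p * B 0%N + A m * q + (m == 0%N)%:R * p * q.
Proof.
transitivity (\sum_(0 <= r < m.+1) (A r * B r + (if r == 0%N then p * B r else 0) +
    (if r == m then A r * q else 0)
    + if r == 0%N then (m == 0%N)%:R * p * q else 0)).
  apply: eq_big_nat => r /andP[_ rm].
  have -> : ((m - r)%N == 0%N) = (r == m) by apply/eqP/eqP; lia.
  case: (eqVneq r 0%N) => [->|_]; last by case: eqP => _ /=; ring.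
  by rewrite [m == _]eq_sym; case: eqP => _ /=; ring.
rewrite !big_split /= -!big_mkcond !big_nat1_eq /= ltnSn; ring.
Qed.

(** Translating all points is the exponential of the derivation x0 |-> 1,
    x1 |-> 0, which takes letters to scalars and hence kills brackets.  In
    depth 0 a Lie element is c x0, hence the exceptional term. *)
Lemma depth_val_translate a : free_lie a ->
  exists c : K, forall r y k, (r < size y)%N ->
    depth_val r a [seq x + k | x <- y] = depth_val r a y + (r == 0%N)%:R * (c * k).
Proof.
elim=> {a} [l|c a b _ [ca IHa] _ [cb IHb]|a b _ [ca IHa] _ [cb IHb]].
- exists (~~ l)%:R => r [|x y] k //= _; rewrite !depth_val_letter.
  case: l => /=; first by rewrite mul0r mulr0 addr0; case: eqP.
  by rewrite eq_sym mul1r !mulr1; case: eqP; rewrite ?mul1r ?mul0r ?addr0.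
- exists (io c * ca + cb) => r y k ry.
  by rewrite !depth_valD !depth_valZ IHa // IHb //; ring.
exists 0 => m y k my; rewrite !depth_val_lie_br.
have expand a' b' ca' cb' : (forall r y k, (r < size y)%N ->
      depth_val r a' [seq x + k | x <- y] = depth_val r a' y + (r == 0%N)%:R * (ca' * k)) ->
    (forall r y k, (r < size y)%N ->
      depth_val r b' [seq x + k | x <- y] = depth_val r b' y + (r == 0%N)%:R * (cb' * k)) ->
    \sum_(0 <= r < m.+1) depth_val r a' [seq x + k | x <- y] *
       depth_val (m - r) b' (drop r [seq x + k | x <- y]) =
    \sum_(0 <= r < m.+1) depth_val r a' y * depth_val (m - r) b' (drop r y) +
      ca' * k * depth_val m b' y + depth_val m a' y * (cb' * k) +
      (m == 0%N)%:R * (ca' * k) * (cb' * k).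
  move=> Ha Hb; have -> : depth_val m b' y = depth_val (m - 0) b' (drop 0 y).
    by rewrite subn0 drop0.
  rewrite -(sum_perturb m (fun r => depth_val r a' y)
    (fun r => depth_val (m - r) b' (drop r y))).
  apply: eq_big_nat => r /andP[_ rm].
  by rewrite -map_drop Ha ?Hb // ?size_drop; lia.
rewrite (expand a b ca cb) // (expand b a cb ca) //; ring.
Qed.

(** The map w |-> (-1)^length reverse(w) is an anti-automorphism that changes
    the sign of the letters, hence of all Lie elements. *)
Lemma depth_val_antipode a : free_lie a -> forall r y, size y = r.+1 ->
  depth_val r a [seq - x | x <- rev y] = (-1) ^+ r.+1 * depth_val r a y.
Proof.
elim=> {a} [l|c a b _ IHa _ IHb|a b _ IHa _ IHb] m y sy.
- rewrite !depth_val_letter; case: l => /=; case: eqP => [mE|_]; rewrite ?mulr0 //.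
    by rewrite -mE sqrrN mulr1 expr1n.
  by move: sy; rewrite -mE; case: y => [|x []] //= _; rewrite !mulr1 mulN1r.
- by rewrite !depth_valD !depth_valZ IHa // IHb // mulrDr mulrCA.
have anti a' b' : (forall r y, size y = r.+1 ->
      depth_val r a' [seq - x | x <- rev y] = (-1) ^+ r.+1 * depth_val r a' y) ->
    (forall r y, size y = r.+1 ->
      depth_val r b' [seq - x | x <- rev y] = (-1) ^+ r.+1 * depth_val r b' y) ->
    \sum_(0 <= r < m.+1) depth_val r a' [seq - x | x <- rev y] *
      depth_val (m - r) b' (drop r [seq - x | x <- rev y]) =
    (-1) ^+ m * \sum_(0 <= r < m.+1) depth_val r b' y * depth_val (m - r) a' (drop r y).
  move=> Ha Hb; rewrite mulr_sumr big_nat_rev.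
  apply: eq_big_nat => r /andP[_ rm]; rewrite add0n subSS subKn //.
  rewrite -depth_val_take -map_take -map_drop take_rev drop_rev sy Ha; last first.
    by rewrite size_drop sy; lia.
  rewrite Hb; last by rewrite size_take sy; case: ifP; lia.
  have -> : (m.+1 - (m - r).+1 = r)%N by lia.
  have -> : (m.+1 - (m - r) = r.+1)%N by lia.
  rewrite depth_val_take mulrACA -exprD [depth_val (m - r) _ _ * _]mulrC; congr (_ * _).
  have -> : ((m - r).+1 + r.+1 = m + 2)%N by lia.
  by rewrite exprD sqrrN expr1n mulr1.
rewrite !depth_val_lie_br !anti // exprS; ring.
Qed.

End LieElements.

(** * From words to reduced polynomials *)

Lemma size_blocks w : size (blocks w) = (depth w).+1.
Proof. by elim: w => [|[] w IH] //=; [rewrite IH|case: (blocks w) IH]. Qed.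

Lemma prod_blocks (K : comNzRingType) (y : seq K) w :
  \prod_(i < (depth w).+1) nth 0 y i ^+ nth 0%N (blocks w) i = word_val y w.
Proof.
elim: w y => [|[] w IH] y.
- by rewrite big_ord_recl big_ord0 expr0 mulr1.
- rewrite -[RHS]/(word_val (behead y) w) -IH [LHS]big_ord_recl expr0 mul1r.
  by apply: eq_bigr => i _; rewrite /= nth_behead.
rewrite -[RHS]/(head 0 y * word_val y w) -IH.
rewrite [in RHS]big_ord_recl [LHS]big_ord_recl mulrA; congr (_ * _).
  by rewrite /= exprS nth0; case: (blocks w).
by apply: eq_bigr => i _ /=; case: (blocks w) (size_blocks w).
Qed.

Lemma mmap_depth_poly (K : comNzRingType) (io : {rmorphism rat -> K}) r a
    (y : seq K) :
  mmap io (fun i : 'I_r.+1 => nth 0 y i) (depth_poly r a) = depth_val io r a y.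
Proof.
rewrite /depth_poly big_mkcond rmorph_sum; apply: eq_bigr => w _ /=.
case: eqP => [wr|_]; last by rewrite rmorph0 mulr0.
rewrite mmapZ mmapX /mmap1 -wr -prod_blocks; congr (_ * _).
by apply: eq_bigr => i _; rewrite mnmE.
Qed.

Lemma mmap_reduced (K : comNzRingType) (io : {rmorphism rat -> K}) r a
    (u : nat -> K) :
  mmap io (fun k : 'I_r => u k) (reduced r a) = depth_val io r a (0 :: mkseq u r).
Proof.
rewrite /reduced /comp_mpoly rmorph_mmap /= -mmap_depth_poly.
apply: eq_mmap => [c|i] /=; first by rewrite mmapC.
rewrite tnth_mktuple; case: unliftP => [j ->|->]; last by rewrite mmap0.
by rewrite lift0 mmapX mmap1U /= nth_mkseq.
Qed.

(** The reduced form uses the points 0, y_1 - y_0, ...; translation by y_0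
    recovers the value at y_0, ..., y_r. *)
Lemma at_pt_reduced m r a e t : free_lie a -> (0 < r)%N -> distinct m r t ->
  at_pt m (reduced r a)%:F e t =
  depth_val (cst m) r a [seq (-1) ^+ e * xvar m k | k <- t].
Proof.
move=> fa r0 gt; have [c trans] := depth_val_translate (cst m) fa.
have /and3P[/eqP st _ _] := gt.
rewrite -[LHS]/(rsubst _ _) (rsubst_tofrac (@alg_free_point r m e t gt)).
rewrite -[LHS]/(mmap _ _ _) (mmap_reduced _ _ _ (fun k => point m e t k.+1 - point m e t 0)).
have := trans r [seq (-1) ^+ e * xvar m k | k <- t] (- point m e t 0).
rewrite size_map st => /(_ (ltnSn r)); rewrite gtn_eqF // mul0r addr0 => <-.
congr depth_val; rewrite -map_comp.
case: t st {gt} => [//|k0 t] [st]; rewrite /= subrr; congr (_ :: _).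
apply: (@eq_from_nth _ 0); rewrite size_mkseq ?size_map ?st // => i ir.
by rewrite nth_mkseq // (nth_map 0%N) ?st.
Qed.

Lemma reduced_depth_val r a :
  (reduced r a)%:F = depth_val (cst r) r a [seq xvar r k | k <- iota 0 r.+1].
Proof.
rewrite /= -[in RHS](addn0 1%N) iotaDl -map_comp.
rewrite -(mmap_reduced (cst r) r a (fun k => xvar r k.+1)).
rewrite -{1}[reduced r a]comp_mpoly_id rmorph_mmap; apply: eq_mmap => // k.
by rewrite [LHS]/= tnth_mktuple /= valK.
Qed.

Lemma antipodal_reduced r a : free_lie a -> (0 < r)%N ->
  antipodal (reduced r a)%:F.
Proof.
move=> fa r0; rewrite /antipodal at_pt_reduced ?distinct_rev ?distinct_iota //.
rewrite reduced_depth_val -(depth_val_antipode (cst r) fa) ?size_map ?size_iota //.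
congr depth_val; rewrite -map_rev -map_comp; apply: eq_map => k /=.
by rewrite expr1 mulN1r.
Qed.

Lemma eq_list_br_map (T U : Type) (R : pzRingType) (h : T -> U) r s (F G : seq U -> R) t :
  list_br r s F G (map h t) = list_br r s (F \o map h) (G \o map h) t.
Proof.
by rewrite /list_br /list_circ; congr (_ - _ - (_ - _)); apply: eq_bigr => i _ /=;
  rewrite map_cat !map_take !map_drop.
Qed.

Lemma depth_val_depth_ge (K : comNzRingType) (io : {rmorphism rat -> K}) d r a y :
  depth_ge d a -> (r < d)%N -> depth_val io r a y = 0.
Proof.
move=> da rd; rewrite /depth_val /lin big_seq big1 // => w /da wd.
by rewrite ifF ?mulr0 //; apply/eqP; lia.
Qed.

(** As the depth 0 parts vanish, the extreme terms of the convolution drop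
    out. *)
Lemma reduced_ihara_nc m a b : free_lie a -> free_lie b ->
  depth_ge 1 a -> depth_ge 1 b -> (0 < m)%N ->
  (reduced m (ihara_nc a b))%:F =
  \sum_(1 <= r < m)
     list_br r (m - r) (at_pt m (reduced r a)%:F false)
       (at_pt m (reduced (m - r) b)%:F false) (iota 0 m.+1).
Proof.
move=> fa fb da db m0; rewrite reduced_depth_val depth_val_ihara_nc ?size_map ?size_iota //.
rewrite big_ltn // big_nat_recr //=.
have zero r (F G : seq (ratfun m) -> ratfun m) t : F =1 (fun=> 0) \/ G =1 (fun=> 0) ->
    list_br r (m - r) F G t = 0.
  by case=> z; rewrite /list_br /list_circ !big1 ?subrr // => i _; rewrite !z ?mul0r ?mulr0.
rewrite zero; last by left=> u; apply: depth_val_depth_ge da _.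
rewrite zero; last by right=> u; rewrite subnn; apply: depth_val_depth_ge db _.
rewrite add0r addr0; apply: eq_big_nat => r /andP[r0 rm].
rewrite -[_ :: _]/(map (xvar m) (iota 0 m.+1)) eq_list_br_map.
have point0 t : [seq (-1) ^+ false * xvar m k | k <- t] = map (xvar m) t.
  by apply: eq_map => k; rewrite expr0 mul1r.
have gm : distinct m (r + (m - r)) (iota 0 m.+1) by rewrite subnKC ?distinct_iota // ltnW.
apply: (eq_list_br gm) => t gt /=.
  by rewrite at_pt_reduced // point0.
by rewrite at_pt_reduced ?subn_gt0 // point0.
Qed.

Lemma blocks_inj : injective blocks.
Proof.
have ne w : blocks w <> [::] by move/(congr1 size); rewrite size_blocks.
elim=> [|[] u IH] [|[] v] //=.
- by case=> /esym/ne.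
- by case=> /ne.
- by case=> /IH ->.
case bu: (blocks u) => [|p s] /=; first by case: (ne u).
case bv: (blocks v) => [|q s'] /=; first by case: (ne v).
by case=> pq ss; rewrite (IH v) // bu bv pq ss.
Qed.

Lemma multinom_blocks_inj r (u v : word) :
  depth u = r -> depth v = r ->
  [multinom nth 0%N (blocks u) i | i < r.+1] =
  [multinom nth 0%N (blocks v) i | i < r.+1] -> u = v.
Proof.
move=> du dv /mnmP uv; apply/eqP; rewrite monalg.fmP; apply/eqP/blocks_inj.
apply: (@eq_from_nth _ 0%N); rewrite !size_blocks ?du ?dv // => i ir.
by have := uv (Ordinal ir); rewrite !mnmE.
Qed.

Lemma mcoeff_depth_poly r a (w : word) : depth w = r ->
  (depth_poly r a)@_[multinom nth 0%N (blocks w) i | i < r.+1] =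
  monalg.mcoeff w a.
Proof.
move=> wr; rewrite /depth_poly raddf_sum /=.
under eq_bigr => v _ do rewrite mcoeffZ mcoeffX.
have [wa|wa] := boolP (w \in monalg.msupp a); last first.
  rewrite (monalg.mcoeff_outdom wa) big_seq_cond big1 // => v /andP[va /eqP vr].
  case: eqP => [/(multinom_blocks_inj vr wr) vw|_]; last by rewrite mulr0.
  by rewrite -vw va in wa.
rewrite (big_rem w) //= wr !eqxx mulr1 big_seq_cond big1 ?addr0 // => v.
rewrite mem_rem_uniq ?fset_uniq // => /andP[/andP[/= vw _] /eqP vr].
case: eqP => [/(multinom_blocks_inj vr wr) /eqP|_]; last by rewrite mulr0.
by rewrite (negPf vw).
Qed.

(** By translation invariance the reduced form determines the depth [r] part as
    a polynomial in y_0, ..., y_r, whose monomials correspond to words. *)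
Lemma depth_geS r a : free_lie a -> (0 < r)%N -> depth_ge r a ->
  reduced r a = 0 -> depth_ge r.+1 a.
Proof.
move=> fa r0 da red0 w wa; rewrite ltn_neqAle da // andbT; apply/eqP => wr.
have [c trans] := depth_val_translate (@mpolyC r.+1 rat) fa.
pose X := [seq 'X_i : {mpoly rat[r.+1]} | i <- enum 'I_r.+1].
have sX : size X = r.+1 by rewrite size_map size_enum_ord.
have XE (i : 'I_r.+1) : nth 0 X i = 'X_i.
  by rewrite (nth_map ord0) ?size_enum_ord // nth_ord_enum.
have dp : depth_poly r a = depth_val (@mpolyC _ _) r a X.
  rewrite -mmap_depth_poly -[LHS]comp_mpoly_id.
  by apply: eq_mmap => // i; rewrite tnth_mktuple XE.
have : depth_poly r a = 0.
  rewrite dp; have := trans r X (- 'X_ord0); rewrite sX ltnSn => /(_ isT).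
  rewrite gtn_eqF // mul0r addr0 => <-.
  pose u k := nth 0 X k.+1 - 'X_ord0.
  have -> : [seq x - 'X_ord0 | x <- X] = 0 :: mkseq u r.
    apply: (@eq_from_nth _ 0); rewrite size_map sX /= ?size_mkseq // => -[|i] ir.
      by rewrite (nth_map 0) ?sX // (XE ord0) /= subrr.
    by rewrite (nth_map 0) ?sX //= nth_mkseq.
  by rewrite -mmap_reduced red0 mmap0.
move=> dp0; have := mcoeff_depth_poly a (esym wr).
rewrite dp0 mcoeff0 => /esym/eqP; rewrite monalg.mcoeff_eq0.
by rewrite wa.
Qed.

(** * Low-depth components of brackets *)

Section LowDepth.
Variables (a b : ncpoly).
Hypotheses (fa : free_lie a) (fb : free_lie b) (da : depth_ge 1 a) (db : depth_ge 1 b).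

Let A r := (reduced r a)%:F : ratfun r.
Let B r := (reduced r b)%:F : ratfun r.

Let list_brE m r s : (r + s)%N = m -> (0 < r)%N -> (0 < s)%N ->
  list_br r s (at_pt m (A r) false) (at_pt m (B s) false) (iota 0 m.+1) =
  at_pt m (ihara (A r) (B s)) false (iota 0 m.+1).
Proof.
move=> rsm r0 s0; rewrite at_pt_ihara //; first exact: antipodal_reduced.
  exact: antipodal_reduced.
by rewrite rsm distinct_iota.
Qed.

Lemma reduced2_ihara_nc : (reduced 2 (ihara_nc a b))%:F = ihara (A 1) (B 1).
Proof.
rewrite reduced_ihara_nc // big_nat1 list_brE //; exact: (at_pt_iota (ihara (A 1) (B 1))).
Qed.

Lemma reduced3_ihara_nc : (reduced 3 (ihara_nc a b))%:F =
  ihara (A 1) (B 2) + ihara (A 2) (B 1).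
Proof.
rewrite reduced_ihara_nc // big_ltn // big_nat1 !list_brE //; congr (_ + _).
  exact: (at_pt_iota (ihara (A 1) (B 2))).
exact: (at_pt_iota (ihara (A 2) (B 1))).
Qed.

Lemma reduced4_ihara_nc : (reduced 4 (ihara_nc a b))%:F =
  ihara (A 1) (B 3) + (ihara (A 2) (B 2) + ihara (A 3) (B 1)).
Proof.
rewrite reduced_ihara_nc // big_ltn // big_ltn // big_nat1 !list_brE //.
congr (_ + (_ + _)).
- exact: (at_pt_iota (ihara (A 1) (B 3))).
- exact: (at_pt_iota (ihara (A 2) (B 2))).
exact: (at_pt_iota (ihara (A 3) (B 1))).
Qed.

End LowDepth.

Lemma reduced_sum r (I : Type) (l : seq I) (P : pred I) (F : I -> ncpoly) :
  (reduced r (\sum_(i <- l | P i) F i))%:F =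
  \sum_(i <- l | P i) (reduced r (F i))%:F.
Proof.
rewrite reduced_depth_val depth_val_sum.
by apply: eq_bigr => i _; rewrite reduced_depth_val.
Qed.

Lemma reducedZ r c a : (reduced r (c *: a))%:F = cst r c * (reduced r a)%:F.
Proof. by rewrite !reduced_depth_val depth_valZ. Qed.

Lemma reduced_depth_ge d r a : depth_ge d a -> (r < d)%N -> reduced r a = 0.
Proof.
move=> da rd; apply/eqP; rewrite -tofrac_eq0 reduced_depth_val.
by rewrite (depth_val_depth_ge _ _ da rd).
Qed.

(** * Brackets of the exponential elements *)

Section Exponential.
Variables a b : ratfun 1.

(** The depths 3 and 4 of {exp(D) a, exp(D) b} = exp(D) {a, b}, where D is the
    derivation ad (s1 + s2). *)
Lemma ihara_exp_depth3 :
  ihara a (ihara s1 b) + ihara (ihara s1 a) b = ihara s1 (ihara a b) :> ratfun 3.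
Proof. by rewrite (ihara_jacobi111 s1 a b) [RHS]addrC. Qed.

Let xi3' (c : ratfun 1) : ratfun 3 :=
  ihara s2 c + cst 3 2%:R^-1 * ihara s1 (ihara s1 c).

Lemma ihara_exp_depth4 :
  ihara a (xi3' b) + (ihara (ihara s1 a) (ihara s1 b) + ihara (xi3' a) b) =
  ihara s2 (ihara a b) + cst 4 2%:R^-1 * ihara s1 (ihara s1 (ihara a b)) :> ratfun 4.
Proof.
have as2 := antipodal_s2; have a1 := antipodal1.
have a11 (f' g' : ratfun 1) := antipodal_ihara (a1 f') (a1 g').
have e : ihara s1 (ihara s1 (ihara a b)) =
    ihara (ihara s1 (ihara s1 a)) b + ihara (ihara s1 a) (ihara s1 b) +
    (ihara (ihara s1 a) (ihara s1 b) + ihara a (ihara s1 (ihara s1 b))) :> ratfun 4.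
  rewrite (ihara_jacobi111 s1 a b : ihara s1 (ihara a b) = _ :> ratfun (1 + 2)).
  rewrite -(ihara_jacobi121 s1 b (a11 s1 a)) -(ihara_jacobi112 s1 a (a11 s1 b)).
  exact: (iharaDr s1 (ihara (ihara s1 a) b : ratfun 3) (ihara a (ihara s1 b))).
rewrite e ihara_jacobi211 //.
have -> : ihara a (xi3' b) = ihara a (ihara s2 b) +
    cst 4 2%:R^-1 * ihara a (ihara s1 (ihara s1 b)).
  by rewrite (iharaDr a) (iharaZr 2%:R^-1 a).
have -> : ihara (xi3' a) b = ihara (ihara s2 a) b +
    cst 4 2%:R^-1 * ihara (ihara s1 (ihara s1 a)) b.
  by rewrite (iharaDl (ihara s2 a) _ b) (iharaZl 2%:R^-1 _ b).
have half : cst 4 2%:R^-1 + cst 4 2%:R^-1 = 1.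
  by rewrite -rmorphD -(rmorph1 (@cst 4)).
move: (ihara a (ihara s2 b)) (ihara (ihara s2 a) b) (ihara a (ihara s1 _))
  (ihara (ihara s1 (ihara s1 a)) b) (ihara (ihara s1 a) (ihara s1 b)) half.
move: (cst 4 _) => c p q u v w half.
by rewrite -[w in LHS]mul1r -half; ring.
Qed.

End Exponential.

(** * Sums against the coefficients of P *)

Lemma antisym_sum (V : zmodType) N (u : nat -> nat -> V) (v : nat -> nat -> V) :
  (forall i, u i i = 0) -> (forall i j, v i j = - u j i) ->
  \sum_(1 <= i < N) \sum_(i.+1 <= j < N) (u i j - v i j) =
  \sum_(1 <= i < N) \sum_(1 <= j < N) u i j.
Proof.
move=> u0 vE.
have upper (w : nat -> nat -> V) :
    \sum_(1 <= i < N) \sum_(i.+1 <= j < N) w i j =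
    \sum_(1 <= i < N) \sum_(1 <= j < N) if (i < j)%N then w i j else 0.
  apply: eq_big_nat => i /andP[i0 _].
  by rewrite (big_nat_widenl i.+1 1 N) //= -big_mkcond.
under eq_bigr => i _ do rewrite sumrB.
rewrite sumrB !upper [X in _ - X]exchange_big -sumrB.
apply: eq_bigr => i _; rewrite -sumrB; apply: eq_bigr => j _.
by rewrite vE; case: ltngtP => [_|_|->]; rewrite ?subr0 ?sub0r ?opprK ?u0.
Qed.

(** The substitution b = j - a; the terms with a + b >= N that the square
    contains and the triangle does not are zero. *)
Lemma triangle_sum (V : zmodType) N (H : nat -> nat -> V) :
  (forall a b, (N <= a + b)%N -> H a b = 0) ->
  \sum_(1 <= j < N) \sum_(1 <= a < j) H a (j - a)%N =
  \sum_(1 <= a < N) \sum_(1 <= b < N) H a b.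
Proof.
move=> H0.
have -> : \sum_(1 <= j < N) \sum_(1 <= a < j) H a (j - a)%N =
    \sum_(1 <= j < N) \sum_(1 <= a < N) if (a < j)%N then H a (j - a)%N else 0.
  apply: eq_big_nat => j /andP[_ jN].
  by rewrite (big_nat_widen 1 j N) ?(ltnW jN) // big_mkcond.
rewrite exchange_big; apply: eq_big_nat => a /andP[a0 aN] /=.
rewrite (big_cat_nat (n := a.+1)) //= big_nat big1 => [|j /andP[_ ja]]; last first.
  by rewrite ifF //; lia.
rewrite add0r -[a.+1]addn1 addnC big_addn.
rewrite (eq_big_nat _ _ (F2 := H a)) => [|b /andP[b0 _]]; last first.
  by rewrite -{1}[a]add0n ltn_add2r b0 addnK.
rewrite [RHS](big_cat_nat (n := (N - a)%N)) //=; [|lia|lia].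
rewrite -[LHS]addr0; congr (_ + _); rewrite big_nat big1 // => b /andP[bN _].
by rewrite H0 //; lia.
Qed.

Lemma lam_big P i j : (msize P <= i + j)%N -> lam P i j = 0.
Proof.
move=> Nij; apply/eqP; rewrite mcoeff_eq0 msize_mdeg_ge //.
rewrite mdegE !big_ord_recl big_ord0 !mnmE /=; apply: leq_trans Nij _; lia.
Qed.

Lemma lam_diag P i : (forall i j, lam P i j = - lam P j i) -> lam P i i = 0.
Proof.
move=> anti; have /eqP := anti i i; rewrite -addr_eq0 -mulr2n -mulr_natr.
by rewrite mulf_eq0 => /orP[/eqP|].
Qed.

Definition lam_sum r (P : {mpoly rat[2]}) (F : nat -> nat -> ratfun r) : ratfun r :=
  \sum_(1 <= i < msize P) \sum_(i.+1 <= j < msize P) cst r (lam P i j) * F i j.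

Lemma reduced_lam_bracket r P s : (reduced r (lam_bracket P s))%:F =
  lam_sum P (fun i j => (reduced r (ihara_nc (s i) (s j)))%:F).
Proof.
rewrite reduced_sum; apply: eq_bigr => i _; rewrite reduced_sum.
by apply: eq_bigr => j _; rewrite reducedZ.
Qed.

Lemma eq_lam_sum r P (F G : nat -> nat -> ratfun r) :
  (forall i j, (0 < i)%N -> (0 < j)%N -> F i j = G i j) ->
  lam_sum P F = lam_sum P G.
Proof.
move=> FG; apply: eq_big_nat => i /andP[i0 _]; apply: eq_big_nat => j /andP[ij _].
by rewrite FG // (leq_trans _ ij).
Qed.

Lemma lam_sumD r P (F G : nat -> nat -> ratfun r) :
  lam_sum P (fun i j => F i j + G i j) = lam_sum P F + lam_sum P G.
Proof.
rewrite -big_split; apply: eq_bigr => i _; rewrite -big_split.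
by apply: eq_bigr => j _; rewrite mulrDr.
Qed.

Lemma lam_sumZ r P c (F : nat -> nat -> ratfun r) :
  lam_sum P (fun i j => c * F i j) = c * lam_sum P F.
Proof.
rewrite mulr_sumr; apply: eq_bigr => i _; rewrite mulr_sumr.
by apply: eq_bigr => j _; rewrite mulrCA.
Qed.

Lemma ihara_lam_sum r s P (f : ratfun r) (F : nat -> nat -> ratfun s) :
  ihara f (lam_sum P F) = lam_sum P (fun i j => ihara f (F i j)).
Proof.
rewrite ihara_sumr; apply: eq_bigr => i _; rewrite ihara_sumr.
by apply: eq_bigr => j _; rewrite iharaZr.
Qed.

Lemma lam_sum_antisym r P (F : nat -> nat -> ratfun r) (G : nat -> nat -> ratfun r) :
  (forall i j, lam P i j = - lam P j i) -> (forall i j, G i j = F j i) ->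
  lam_sum P (fun i j => F i j - G i j) =
  \sum_(1 <= i < msize P) \sum_(1 <= j < msize P) cst r (lam P i j) * F i j.
Proof.
move=> anti GF.
rewrite -(@antisym_sum _ _ (fun i j => cst r (lam P i j) * F i j)
  (fun i j => cst r (lam P i j) * G i j)).
- by apply: eq_bigr => i _; apply: eq_bigr => j _; rewrite mulrBr.
- by move=> i; rewrite (lam_diag _ anti) rmorph0 mul0r.
by move=> i j; rewrite anti GF rmorphN mulNr.
Qed.

Lemma motivic_lam_bracket g P s : motivic_lie g ->
  (forall n, (0 < n)%N -> g (s n)) -> g (lam_bracket P s).
Proof.
move=> hg gs; have gD x y : g x -> g y -> g (x + y).
  by move=> gx gy; rewrite -[x]scale1r; exact: motivic_lin.
have gZ c x : g x -> g (c *: x).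
  by move=> gx; rewrite -[_ *: _]addr0; apply: motivic_lin gx (motivic0 hg).
rewrite /lam_bracket big_seq; apply: (big_ind g) => [||i].
- exact: motivic0.
- exact: gD.
rewrite mem_index_iota big_seq => /andP[i0 _].
apply: (big_ind g) => [||j]; [exact: motivic0|exact: gD|].
rewrite mem_index_iota => /andP[ij _]; apply/gZ/(motivic_ihara hg); apply: gs => //.
exact: leq_trans i0 (ltnW ij).
Qed.

(** * The image of a relation in depth 4 *)

Theorem theorem8p5
    (g : ncpoly -> Prop) (hg : motivic_lie g)
    (sigma_c : nat -> ncpoly)
    (hsigma : forall n, (0 < n)%N -> is_sigma_c g n (sigma_c n))
    (P : {mpoly rat[2]}) (hP : in_K g P) :
  let N := msize P in
  let cP := lam_bracket P sigma_c in
  [/\ g cP, depth_ge 4 cP &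
      (reduced 4 cP)%:F =
        \sum_(1 <= i < N) \sum_(1 <= a < N) \sum_(1 <= b < N)
           cst 4 (lam P i (a + b) * bern_coef a b)
           * ihara (mon (2 * i)%N) (ihara_mon2 a b)
        - cst 4 (3%:R / 12%:R)
          * \sum_(1 <= i < N) cst 4 (lam P i 1) * ihara (mon (2 * i)%N) z3].
Proof.
move=> N cP; pose s := sigma_c.
have anti := K_antisym hP.
have lift n : (0 < n)%N -> is_lift g n (s n) by case/hsigma.
have fs n : (0 < n)%N -> free_lie (s n).
  by move/lift=> [gs _ _]; exact: motivic_free_lie hg _ gs.
have ds n : (0 < n)%N -> depth_ge 1 (s n) by move/lift=> [].
have r1 n : (0 < n)%N -> (reduced 1 (s n))%:F = xi1 n by move/lift=> [].
have r2 n : (0 < n)%N -> (reduced 2 (s n))%:F = xi2 n by move/hsigma=> [].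
have r3 n : (0 < n)%N -> (reduced 3 (s n))%:F = sigma_c3 n by move/hsigma=> [].
have gcP : g cP by apply: motivic_lam_bracket hg _ => n /lift[].
have fcP := motivic_free_lie hg gcP.
have d3 : depth_ge 3 cP := K_ker hP lift.
have rel2 : lam_sum P (fun i j => ihara (xi1 i) (xi1 j)) = 0 :> ratfun 2.
  have := reduced_lam_bracket 2 P s; rewrite (reduced_depth_ge d3) // tofrac0.
  move=> ->; apply: eq_lam_sum => i j i0 j0.
  by rewrite (reduced2_ihara_nc (fs i i0) (fs j j0) (ds i i0) (ds j j0)) !r1.
have red3 : reduced 3 cP = 0.
  apply/eqP; rewrite -tofrac_eq0; apply/eqP; rewrite reduced_lam_bracket.
  transitivity (ihara s1 (0 : ratfun 2)); last exact: (@ihara0r 1 2 s1).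
  rewrite -rel2 ihara_lam_sum; apply: eq_lam_sum => i j i0 j0.
  rewrite (reduced3_ihara_nc (fs i i0) (fs j j0) (ds i i0) (ds j j0)) !r1 ?r2 //.
  exact: ihara_exp_depth3.
have d4 : depth_ge 4 cP by exact: depth_geS red3.
split=> //; rewrite reduced_lam_bracket.
pose beta n : ratfun 3 :=
  \sum_(1 <= a < n) cst 3 (bern_coef a (n - a)) * ihara_mon2 a (n - a).
(* The deviation of the depth 3 part of sigma_n from the exponential. *)
pose tau n : ratfun 3 := beta n - (if n == 1%N then xi3 1 else 0).
have sigmaE n : sigma_c3 n = xi3 n + tau n.
  rewrite /sigma_c3 /tau; case: eqP => [->|_]; last by rewrite subr0.
  by rewrite /beta big_geq // sub0r subrr.
pose F i j : ratfun 4 := ihara (xi1 i) (tau j).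
have brE i j : (0 < i)%N -> (0 < j)%N -> (reduced 4 (ihara_nc (s i) (s j)))%:F =
    (ihara s2 (ihara (xi1 i) (xi1 j))
     + cst 4 2%:R^-1 * ihara s1 (ihara s1 (ihara (xi1 i) (xi1 j)))) + (F i j - F j i).
  move=> i0 j0.
  rewrite (reduced4_ihara_nc (fs i i0) (fs j j0) (ds i i0) (ds j j0)) !r1 ?r2 ?r3 //.
  rewrite !sigmaE -ihara_exp_depth4.
  rewrite (iharaDr (xi1 i) (xi3 j)) (iharaDl (xi3 i) (tau i) (xi1 j)).
  rewrite (ihara13_antisym (xi1 j) (tau i)) -/(F i j) -/(F j i).
  by rewrite [X in _ + X]addrA addrACA.
have z2 : lam_sum P (fun i j => ihara s2 (ihara (xi1 i) (xi1 j))) = 0 :> ratfun 4.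
  transitivity (ihara s2 (0 : ratfun 2)); last exact: (@ihara0r 2 2 s2).
  by rewrite -rel2 ihara_lam_sum.
have z1 : lam_sum P (fun i j => ihara s1 (ihara s1 (ihara (xi1 i) (xi1 j)))) = 0
    :> ratfun 4.
  transitivity (ihara s1 (ihara s1 (0 : ratfun 2))).
    by rewrite -rel2 !ihara_lam_sum.
  by rewrite (@ihara0r 1 2 s1); exact: (@ihara0r 1 3 s1).
transitivity (lam_sum P (fun i j => ihara s2 (ihara (xi1 i) (xi1 j)) : ratfun 4)
  + cst 4 2%:R^-1 *
    lam_sum P (fun i j => ihara s1 (ihara s1 (ihara (xi1 i) (xi1 j))) : ratfun 4)
  + lam_sum P (fun i j => F i j - F j i)).
  by rewrite -lam_sumZ -!lam_sumD; exact: eq_lam_sum.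
rewrite z2 z1 mulr0 !add0r (lam_sum_antisym (F := F)) //.
rewrite mulr_sumr -sumrB; apply: eq_big_nat => i /andP[i0 iN].
pose H a b : ratfun 4 :=
  cst 4 (lam P i (a + b) * bern_coef a b) * ihara (mon (2 * i)%N) (ihara_mon2 a b).
have FE j : F i j =
    \sum_(1 <= a < j) cst 4 (bern_coef a (j - a))
      * ihara (mon (2 * i)%N) (ihara_mon2 a (j - a))
    - (if j == 1%N then ihara (xi1 i) (xi3 1) else 0).
  transitivity (ihara (xi1 i) (beta j)
                + ihara (xi1 i) (- (if j == 1%N then xi3 1 else 0))).
    exact: (@iharaDr 1 3 (xi1 i) (beta j) (- _)).
  congr (_ + _).
    rewrite /beta ihara_sumr; apply: eq_bigr => a _.
    exact: (@iharaZr 1 3 _ (xi1 i)).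
  rewrite [LHS]iharaNr; congr (- _); case: eqP => // _; exact: (@ihara0r 1 3).
(* The terms of tau_j: the Bernoulli part with b = j - a, and j = 1. *)
transitivity (\sum_(1 <= j < N) \sum_(1 <= a < j) H a (j - a)%N
  - \sum_(1 <= j < N | j == 1%N) cst 4 (lam P i j) * ihara (xi1 i) (xi3 1)).
  rewrite [X in _ - X]big_mkcond -sumrB; apply: eq_bigr => j _.
  rewrite FE mulrBr mulr_sumr; congr (_ - _); last by case: eqP; rewrite ?mulr0.
  apply: eq_big_nat => a /andP[_ aj].
  rewrite /H subnKC ?(ltnW aj) // [cst 4 (_ * _)]rmorphM; exact: mulrA.
have H0 a b : (N <= a + b)%N -> H a b = 0.
  by move=> Nab; rewrite /H lam_big ?(leq_trans Nab) ?leq_addl // mul0r rmorph0 mul0r.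
apply: (etrans (congr1 (fun x => x - _) (triangle_sum H0))).
rewrite big_nat1_eq (leq_ltn_trans i0 iN) /= [in RHS]mulrCA; congr (_ - _ * _).
rewrite xi3_1; exact: (@iharaZr 1 3 _ (xi1 i)).
Qed.
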